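(* Let $(M,g)$ be a Riemannian manifold whose Levi-Civita connection $\nabla$ is flat, let $f_1>0$ be a constant, let $f_2=e^{2\varphi_2}$ with $\varphi_2$ a smooth function on $M$, and put $\delta=f_2/f_1$. Let $TM$ carry the metric $G=g^{f_1,f_2}=f_1\pi^*g\oplus f_2\pi^*g$ on $H\oplus V=TTM$, so that its Levi-Civita connection is $$\nabla^G_XY=\nabla_XY+X(\varphi_2)Y^v+Y(\varphi_2)X^v-\delta\langle X^v,Y^v\rangle\,\mathrm{grad}\,\varphi_2 .$$ Then the Riemannian curvature tensor of $(TM,G)$ is given, for all $X,Y,Z$ tangent to $TM$, by $$\begin{aligned} R^G(X,Y)Z\ =\ &\bigl(X(\varphi_2)Z(\varphi_2)+\delta\epsilon^2\langle X^v,Z^v\rangle+\langle\nabla_X\mathrm{grad}\,\varphi_2,Z\rangle\bigr)Y^v\\ &-\bigl(Y(\varphi_2)Z(\varphi_2)+\delta\epsilon^2\langle Y^v,Z^v\rangle+\langle\nabla_Y\mathrm{grad}\,\varphi_2,Z\rangle\bigr)X^v\\ &-\delta\bigl(X(\varphi_2)\langle Y^v,Z^v\rangle-Y(\varphi_2)\langle X^v,Z^v\rangle\bigr)\mathrm{grad}\,\varphi_2\\ &-\delta\langle Y^v,Z^v\rangle\nabla_X\mathrm{grad}\,\varphi_2+\delta\langle X^v,Z^v\rangle\nabla_Y\mathrm{grad}\,\varphi_2, \end{aligned}$$ where $\epsilon=\|\mathrm{grad}\,\varphi_2\|$.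
   Context: Let $\pi:TM\to M$ be the tangent bundle. The Levi-Civita connection $\nabla$ of $(M,g)$ induces the splitting $TTM=H\oplus V$, with $V=\ker d\pi$ the vertical bundle and $H$ the horizontal bundle; both are identified with $\pi^*TM$ ($H$ via $d\pi$, $V$ via $V_u=T_{\pi(u)}M$). For $X\in TTM$ write $X=X^h+X^v$ with $X^h\in H$, $X^v\in V$. Functions on $M$ are regarded as functions on $TM$ by composing with $\pi$, so $X(\varphi_2)=d\varphi_2(d\pi X)$. The bracket $\langle\cdot,\cdot\rangle=g^{1,1}=\pi^*g\oplus\pi^*g$ is the Sasaki metric. On $TTM=H\oplus V$, $\nabla$ denotes the connection $\pi^*\nabla\oplus\pi^*\nabla$. The vector field $\mathrm{grad}\,\varphi_2$ is the $g$-gradient of $\varphi_2$ on $M$, lifted to a section of $H$, and $\|\mathrm{grad}\,\varphi_2\|$ is its $g$-norm. The metric $g^{f_1,f_2}$ makes $H$ and $V$ orthogonal and equals $f_1\pi^*g$ on $H$ and $f_2\pi^*g$ on $V$. Curvature convention: $R(X,Y)Z=\nabla_X\nabla_YZ-\nabla_Y\nabla_XZ-\nabla_{[X,Y]}Z$. *)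

(* Defs.v *)
From HB Require Import structures.
From mathcomp Require Import all_boot all_order all_algebra.
From mathcomp Require Import all_classical all_reals all_analysis.
Import Order.TTheory GRing.Theory Num.Theory.
Import numFieldNormedType.Exports.

Set Implicit Arguments.
Unset Strict Implicit.
Unset Printing Implicit Defensive.

Local Open Scope classical_set_scope.
Local Open Scope ring_scope.

(* C^k on an open subset U of a finite-dimensional space. *)
Fixpoint Ck_on {R : realType} {E F : normedModType R} (k : nat) (U : set E)
    (f : E -> F) : Prop :=
  match k with
  | 0%N => forall x, U x -> {for x, continuous f}
  | k'.+1 => (forall x, U x -> differentiable f x) /\
             (forall v : E, Ck_on k' U ('D_v f))
  end.

Definition smooth_on {R : realType} {E F : normedModType R} (U : set E)
    (f : E -> F) : Prop := forall k, Ck_on k U f.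

(* Charts on a set of points; [param i] is the inverse of [chart i], meaningful
   on the image of [dom i] only.  [chart_at p] is a preferred chart at p. *)
Record atlas (R : realType) (E : normedModType R) := Atlas {
  pt : Type;
  idx : Type;
  chart_at : pt -> idx;
  dom : idx -> set pt;
  chart : idx -> pt -> E;
  param : idx -> E -> pt }.

Definition trans {R : realType} {E : normedModType R} (A : atlas E)
    (i j : idx A) (x : E) : E := chart j (param i x).

(* W is open for the topology that the atlas induces on its set of points. *)
Definition aopen {R : realType} {E : normedModType R} (A : atlas E)
    (W : set (pt A)) : Prop :=
  forall i : idx A, open (chart i @` (dom i `&` W)).

Record smooth_atlas {R : realType} {E : normedModType R} (A : atlas E) :
    Prop := SmoothAtlas {
  chart_at_dom : forall p : pt A, dom (chart_at p) p;
  chartK : forall (i : idx A) (p : pt A), dom i p -> param i (chart i p) = p;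
  overlap_open : forall i j : idx A, open (chart i @` (dom i `&` dom j));
  trans_smooth : forall i j : idx A,
    smooth_on (chart i @` (dom i `&` dom j)) (trans i j) }.

Definition ahausdorff {R : realType} {E : normedModType R} (A : atlas E) :
    Prop :=
  forall p q : pt A, p <> q -> exists U V : set (pt A),
    [/\ aopen U, aopen V, U p, V q & U `&` V = set0].

Definition asecond_countable {R : realType} {E : normedModType R}
    (A : atlas E) : Prop :=
  exists B : nat -> set (pt A), (forall k, aopen (B k)) /\
    forall (W : set (pt A)) (p : pt A), aopen W -> W p ->
      exists k, B k p /\ B k `<=` W.

Record manifold {R : realType} {n : nat} (A : atlas 'rV[R]_n) : Prop :=
  Manifold {
  manifold_smooth : smooth_atlas A;
  manifold_hausdorff : ahausdorff A;
  manifold_second_countable : asecond_countable A }.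

(* The tangent space at p is the model space E: a tangent vector at p is given
   by its coordinates in the preferred chart [chart_at p].  Vector fields are
   hence functions [pt A -> E]. *)

(* Coordinates, in the chart i, of the tangent vector v at p. *)
Definition coord {R : realType} {E : normedModType R} {A : atlas E}
    (i : idx A) (p : pt A) (v : E) : E :=
  'd (trans (chart_at p) i) (chart (chart_at p) p) v.

(* The tangent vector at p with coordinates b in the chart i; [vec i b] is the
   coordinate vector field of the chart i with constant components b. *)
Definition vec {R : realType} {E : normedModType R} {A : atlas E}
    (i : idx A) (b : E) (p : pt A) : E :=
  'd (trans i (chart_at p)) (chart i p) b.

Definition in_chart {R : realType} {E : normedModType R} {A : atlas E}
    (i : idx A) (X : pt A -> E) (x : E) : E :=
  coord i (param i x) (X (param i x)).

Definition smooth_fun {R : realType} {E : normedModType R} {A : atlas E}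
    (W : set (pt A)) (f : pt A -> R) : Prop :=
  forall i : idx A, smooth_on (chart i @` (dom i `&` W)) (f \o param i).

Definition smooth_vf {R : realType} {E : normedModType R} {A : atlas E}
    (W : set (pt A)) (X : pt A -> E) : Prop :=
  forall i : idx A, smooth_on (chart i @` (dom i `&` W)) (in_chart i X).

(* v(f) = df_p(v) *)
Definition vder {R : realType} {E : normedModType R} {A : atlas E}
    (p : pt A) (v : E) (f : pt A -> R) : R :=
  'd (f \o param (chart_at p)) (chart (chart_at p) p) v.

(* [X, Y] = DY(X) - DX(Y) in coordinates *)
Definition lie {R : realType} {E : normedModType R} {A : atlas E}
    (X Y : pt A -> E) (p : pt A) : E :=
  'd (in_chart (chart_at p) Y) (chart (chart_at p) p) (X p)
  - 'd (in_chart (chart_at p) X) (chart (chart_at p) p) (Y p).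

Record riemannian {R : realType} {E : normedModType R} {A : atlas E}
    (g : pt A -> E -> E -> R) : Prop := Riemannian {
  metric_linear : forall p u a v w,
    g p u (a *: v + w) = a * g p u v + g p u w;
  metric_sym : forall p u v, g p u v = g p v u;
  metric_pos : forall p u, u != 0 -> 0 < g p u u;
  metric_smooth : forall (W : set (pt A)) X Y,
    aopen W -> smooth_vf W X -> smooth_vf W Y ->
    smooth_fun W (fun p => g p (X p) (Y p)) }.

(* [nabla p v Y] is the covariant derivative at p, in the direction v, of a
   vector field Y that is smooth near p; it is unconstrained on other Y. *)
Record connection {R : realType} {E : normedModType R} {A : atlas E}
    (nabla : pt A -> E -> (pt A -> E) -> E) : Prop := Connection {
  conn_local : forall (W : set (pt A)) Y Y' p v,
    aopen W -> W p -> smooth_vf W Y -> smooth_vf W Y' ->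
    (forall q, W q -> Y q = Y' q) -> nabla p v Y = nabla p v Y';
  conn_linear : forall (W : set (pt A)) Y p a u v,
    aopen W -> W p -> smooth_vf W Y ->
    nabla p (a *: u + v) Y = a *: nabla p u Y + nabla p v Y;
  conn_add : forall (W : set (pt A)) Y Y' p v,
    aopen W -> W p -> smooth_vf W Y -> smooth_vf W Y' ->
    nabla p v (fun q => Y q + Y' q) = nabla p v Y + nabla p v Y';
  conn_leibniz : forall (W : set (pt A)) f Y p v,
    aopen W -> W p -> smooth_fun W f -> smooth_vf W Y ->
    nabla p v (fun q => f q *: Y q) = vder p v f *: Y p + f p *: nabla p v Y;
  conn_smooth : forall (W : set (pt A)) X Y,
    aopen W -> smooth_vf W X -> smooth_vf W Y ->
    smooth_vf W (fun p => nabla p (X p) Y) }.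

Record levi_civita {R : realType} {E : normedModType R} {A : atlas E}
    (g : pt A -> E -> E -> R) (nabla : pt A -> E -> (pt A -> E) -> E) :
    Prop := LeviCivita {
  lc_connection : connection nabla;
  lc_torsion_free : forall (W : set (pt A)) X Y p,
    aopen W -> W p -> smooth_vf W X -> smooth_vf W Y ->
    nabla p (X p) Y - nabla p (Y p) X = lie X Y p;
  lc_metric : forall (W : set (pt A)) Y Z p v,
    aopen W -> W p -> smooth_vf W Y -> smooth_vf W Z ->
    vder p v (fun q => g q (Y q) (Z q))
    = g p (nabla p v Y) (Z p) + g p (Y p) (nabla p v Z) }.

Definition curvature {R : realType} {E : normedModType R} {A : atlas E}
    (nabla : pt A -> E -> (pt A -> E) -> E) (X Y Z : pt A -> E) (p : pt A) :
    E :=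
  nabla p (X p) (fun q => nabla q (Y q) Z)
  - nabla p (Y p) (fun q => nabla q (X q) Z)
  - nabla p (lie X Y p) Z.

Definition flat {R : realType} {E : normedModType R} {A : atlas E}
    (nabla : pt A -> E -> (pt A -> E) -> E) : Prop :=
  forall (W : set (pt A)) X Y Z p, aopen W -> W p ->
    smooth_vf W X -> smooth_vf W Y -> smooth_vf W Z ->
    curvature nabla X Y Z p = 0.

(* The unique vector w with g(w, v) = df(v) for all v. *)
Definition grad {R : realType} {E : normedModType R} {A : atlas E}
    (g : pt A -> E -> E -> R) (f : pt A -> R) (p : pt A) : E :=
  xget 0 [set w | forall v, g p w v = vder p v f].

(* The tangent bundle: its points are pairs (p, u) with u tangent at p, and each
   chart of M induces the chart (p, u) |-> (coordinates of p, coordinates of u).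
   The preferred chart at (p, u) is the one induced by [chart_at p]. *)
Definition TM {R : realType} {E : normedModType R} (A : atlas E) :
    atlas (E * E)%type :=
  @Atlas R (E * E)%type (pt A * E)%type (idx A)
    (fun P => chart_at P.1)
    (fun i => [set P | dom i P.1])
    (fun i P => (chart i P.1, coord i P.1 P.2))
    (fun i z => (param i z.1, vec i z.2 (param i z.1))).

(* A vector tangent to TM at P is a pair xi = (a, b); with the choice of
   preferred charts above, d pi xi = a. *)
Definition dpi {R : realType} {E : normedModType R} {A : atlas E}
    (P : pt (TM A)) (xi : E * E) : E := xi.1.

(* The Christoffel symbol Gamma(a, u) of the preferred chart at P = (p, u). *)
Definition christoffel {R : realType} {E : normedModType R} {A : atlas E}
    (nabla : pt A -> E -> (pt A -> E) -> E) (P : pt (TM A)) (a : E) : E :=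
  nabla P.1 a (vec (chart_at P.1) P.2).

(* V = ker (d pi) is identified with T_pM by [vlift], and H with T_pM by d pi,
   with inverse [hlift].  [vcomp] is the V-component, seen in T_pM (connection
   map): it maps the velocity of a curve (p(t), u(t)) to Du/dt. *)
Definition vcomp {R : realType} {E : normedModType R} {A : atlas E}
    (nabla : pt A -> E -> (pt A -> E) -> E) (P : pt (TM A)) (xi : E * E) : E :=
  xi.2 + christoffel nabla P xi.1.

Definition hlift {R : realType} {E : normedModType R} {A : atlas E}
    (nabla : pt A -> E -> (pt A -> E) -> E) (P : pt (TM A)) (a : E) : E * E :=
  (a, - christoffel nabla P a).

Definition vlift {R : realType} {E : normedModType R} {A : atlas E}
    (P : pt (TM A)) (b : E) : E * E := (0, b).

Definition vpart {R : realType} {E : normedModType R} {A : atlas E}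
    (nabla : pt A -> E -> (pt A -> E) -> E) (P : pt (TM A)) (xi : E * E) :
    E * E := vlift P (vcomp nabla P xi).

(* The connection pi^*nabla on pi^*TM, whose sections are the functions s with
   s P tangent to M at pi P: in the chart i of M, with the components of s and
   of nabla, it is ds(xi) + Gamma(d pi xi, s). *)
Definition pullback_conn {R : realType} {E : normedModType R} {A : atlas E}
    (nabla : pt A -> E -> (pt A -> E) -> E) (P : pt (TM A)) (xi : E * E)
    (s : pt (TM A) -> E) : E :=
  let i : idx (TM A) := chart_at P in
  'd (fun z : E * E =>
        coord (i : idx A) (param i z).1 (s (param i z))) (chart i P) xi
  + nabla P.1 (dpi P xi) (vec (i : idx A) (s P)).

(* pi^*nabla (+) pi^*nabla on H (+) V = TTM *)
Definition conn_HV {R : realType} {E : normedModType R} {A : atlas E}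
    (nabla : pt A -> E -> (pt A -> E) -> E) (P : pt (TM A)) (xi : E * E)
    (S : pt (TM A) -> E * E) : E * E :=
  hlift nabla P (pullback_conn nabla P xi (fun Q => dpi Q (S Q)))
  + vlift P (pullback_conn nabla P xi (fun Q => vcomp nabla Q (S Q))).

(* g^{f1,f2} = f1 pi^*g (+) f2 pi^*g *)
Definition weighted_metric {R : realType} {E : normedModType R} {A : atlas E}
    (g : pt A -> E -> E -> R) (nabla : pt A -> E -> (pt A -> E) -> E)
    (f1 f2 : pt A -> R) (P : pt (TM A)) (xi eta : E * E) : R :=
  f1 P.1 * g P.1 (dpi P xi) (dpi P eta)
  + f2 P.1 * g P.1 (vcomp nabla P xi) (vcomp nabla P eta).

Definition sasaki {R : realType} {E : normedModType R} {A : atlas E}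
    (g : pt A -> E -> E -> R) (nabla : pt A -> E -> (pt A -> E) -> E) :
    pt (TM A) -> E * E -> E * E -> R :=
  weighted_metric g nabla (fun=> 1) (fun=> 1).

(* Main.v *)
(** The connection given by the explicit formula is torsion-free because nabla
    is flat, and compatible with [G] by the product rule, so it is the
    Levi-Civita connection by the usual uniqueness argument.  For the curvature,
    this formula is applied twice: pi^*nabla (+) pi^*nabla is flat, so that its
    second derivatives cancel, and the remaining terms are sorted with the
    symmetry of the Hessian of phi2.  A tangent vector of TM is handled through
    its two components [dpi] and [vcomp].  The tangent space at each point is
    given in the preferred chart of that point, so near P everything is first
    transported to a single chart i, where pi^*nabla is d + Gamma. *)
Require Import Defs.
From HB Require Import structures.
From mathcomp Require Import all_boot all_order all_algebra.
From mathcomp Require Import all_classical all_reals all_analysis.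
From mathcomp Require Import ring lra.
Import Order.TTheory GRing.Theory Num.Theory.
Import numFieldNormedType.Exports.
Set Implicit Arguments.
Unset Strict Implicit.
Unset Printing Implicit Defensive.
Local Open Scope classical_set_scope.
Local Open Scope ring_scope.

(** Flatness is used twice, for different reasons. The vertical part of a field Y on TM is the
    covariant derivative along Y of the tautological section (p, u) |-> u of pi^*TM, so the vertical
    torsion of pi^*nabla (+) pi^*nabla at (p, u) is R(X, Y)u; later the same vanishing curvature
    makes second covariant derivatives of arbitrary sections commute. Both uses come down to one
    identity between Christoffel symbols, [gam_flat]. What shapes the analytic part is that
    smoothness is given for directional derivatives in fixed directions, and that Gamma and g are
    known to be smooth only for fixed arguments, while the formulas differentiate Gamma(a, b), g(a,
    b) and df(c) with all arguments moving with the point. Expanding the arguments in a basis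
    reduces each such expression to finite sums of products. Since f1 is constant, differentiating
    delta only produces the factor 2 X(phi2); the gradient is differentiated only once. *)

Local Notation coord := Defs.coord.

(** * Calculus *)

Section Differentials.
Context {R : realType}.
Implicit Types D E F G : normedModType R.

(** A differential depends only on the germ: the first-order expansion of f at x is one of g as
    well, and such an expansion is unique. Chart identities hold only near a point, so nearly every
    differential below is computed through this lemma. *)
Lemma near_eq_is_diff E F (f g : E -> F) x df :
  {near x, f =1 g} -> is_diff x f df -> is_diff x g df.
Proof.
move=> fg [fx dfE].
have gE : g \o shift x = cst (g x) + 'd f x +o_ 0 id.
  apply/eqaddoP => _ /posnumP[e].
  have /eqaddoP/(_ e%:num (gt0 e)) := diff_locally fx.
  have fg0 : \forall h \near 0, f (h + x) = g (h + x).
    by move: fg => /=; rewrite (near_shift 0 x) subr0.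
  apply: filterS2 fg0 => h fgh.
  by rewrite -![(_ + _ : _ -> _) _]/(_ + _) -![(- _ : _ -> _) _]/(- _) /=
    /cst fgh (nbhs_singleton fg).
have dgE : 'd g x = 'd f x :> (E -> F).
  by apply: diff_unique gE; apply: diff_continuous.
split; last by rewrite dgE.
by apply/diff_locallyP; rewrite dgE; split=> //; apply: diff_continuous.
Qed.

Lemma near_eq_diff E F (f g : E -> F) x :
  {near x, f =1 g} -> differentiable f x -> 'd g x = 'd f x :> (E -> F).
Proof. by move=> fg fx; case: (near_eq_is_diff fg (differentiableP fx)). Qed.

Lemma near_eq_differentiable E F (f g : E -> F) x :
  {near x, f =1 g} -> differentiable f x -> differentiable g x.
Proof. by move=> fg fx; case: (near_eq_is_diff fg (differentiableP fx)). Qed.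

Lemma open_near_eq E F (f g : E -> F) (U : set E) x :
  open U -> U x -> (forall y, U y -> f y = g y) -> {near x, f =1 g}.
Proof.
move=> Uo Ux fg; near do apply: fg; exact: open_nbhs_nbhs.
Unshelve. all: by end_near. Qed.

(** The Leibniz rule for a scalar function times a vector-valued one, obtained by composing with
    scaling packaged as a bilinear map. *)
Lemma is_diffZ_vec E F (f : E -> R) (g : E -> F) x df dg :
  is_diff x f df -> is_diff x g dg ->
  is_diff x (fun y => f y *: g y) (fun v => df v *: g x + f x *: dg v).
Proof.
move=> fx gx.
have blin : bilinear_for
    (GRing.Scale.Law.clone _ _ *:%R _) (GRing.Scale.Law.clone _ _ *:%R _)
    (fun (a : R) (w : F) => a *: w).
  split=> [u'|u] a y z /=; first by rewrite scalerDl scalerA.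
  by rewrite scalerDr !scalerA mulrC.
pose blM := bilinear_isBilinear.Build R _ _ _ _ _ _ blin.
pose bl : {bilinear R -> F -> F} := HB.pack (fun (a : R) (w : F) => a *: w) blM.
have blc : continuous (fun p : R * F => bl p.1 p.2).
  by move=> p; apply: scale_continuous.
have -> : (fun y => f y *: g y) = (fun p => bl p.1 p.2) \o (fun y => (f y, g y)).
  by [].
have bd p : is_diff p (fun p => bl p.1 p.2)
     (fun q => bl p.1 q.2 + bl q.1 p.2).
  apply: DiffDef; last exact: diff_bilin.
  exact: differentiable_bilin.
have [d dE] := is_diff_comp (is_diff_pair fx gx) (bd _).
by split=> //; rewrite dE; apply/funext => v /=; rewrite addrC.
Qed.

Lemma is_diffZ_const E F (c : R) (f : E -> F) x df :
  is_diff x f df -> is_diff x (fun y => c *: f y) (fun v => c *: df v).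
Proof. exact: is_diffZ. Qed.

Lemma is_diff_linear E F (f : {linear E -> F}) x :
  continuous f -> is_diff x f f.
Proof.
by move=> fc; apply: DiffDef; [exact: linear_differentiable|exact: diff_lin].
Qed.

Lemma is_diff_big E F (I : finType) (f df : I -> E -> F) x :
  (forall i, is_diff x (f i) (df i)) ->
  is_diff x (fun y => \sum_i f i y) (fun v => \sum_i df i v).
Proof.
move=> fx.
have -> : (fun y => \sum_i f i y) = \sum_i f i.
  by apply/funext => y; rewrite fct_sumE.
have -> : (fun y => \sum_i df i y) = \sum_i df i.
  by apply/funext => y; rewrite fct_sumE.
elim/big_ind2: _ => // [|f1 df1 f2 df2 h1 h2]; first exact: is_diff_cst.
exact: is_diffD.
Qed.

End Differentials.

(* The derivatives in [Ck_on] are directional, so its chain rule [Ck_on_comp]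
   needs a basis of the intermediate space. *)
Record lin_basis {R : realType} (E : normedModType R) := LinBasis {
  bidx : finType;
  bvec : bidx -> E;
  bco : bidx -> {linear E -> R};
  bco_continuous : forall k, continuous (bco k);
  bcoE : forall x, x = \sum_k bco k x *: bvec k }.
Arguments bvec {R E} l k : rename.
Arguments bco {R E} l k : rename.
Arguments bco_continuous {R E} l k : rename.

Lemma bco_inj (R : realType) (E : normedModType R) (B : lin_basis E) (x y : E) :
  (forall k, bco B k x = bco B k y) -> x = y.
Proof.
move=> xy; rewrite (bcoE B x) (bcoE B y).
by apply: eq_bigr => k _; rewrite xy.
Qed.

Section Ck.
Context {R : realType}.
Implicit Types D E F G : normedModType R.

Lemma Ck_on_sub E F k (U V : set E) (f : E -> F) :
  V `<=` U -> Ck_on k U f -> Ck_on k V f.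
Proof.
move=> VU; elim: k f => [|k IHk] f /=; first by move=> fU x /VU /fU.
by move=> [fU fk]; split=> [x /VU /fU//|v]; apply: IHk.
Qed.

Lemma Ck_onW E F k (U : set E) (f : E -> F) : Ck_on k.+1 U f -> Ck_on k U f.
Proof.
elim: k f => [|k IHk] f; last by move=> [fU fk]; split=> // v; apply: IHk.
by move=> [fU _] x Ux; apply: differentiable_continuous; apply: fU.
Qed.

Lemma Ck_on_eq E F k (U : set E) (f g : E -> F) : open U ->
  (forall x, U x -> f x = g x) -> Ck_on k U f -> Ck_on k U g.
Proof.
move=> Uo; elim: k f g => [|k IHk] f g fg /=.
  move=> fU x Ux; have fgx := open_near_eq Uo Ux fg.
  suff : g @ x --> g x by [].
  rewrite -(fg _ Ux); apply: cvg_trans (fU x Ux).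
  exact: near_eq_cvg.
move=> [fU fk]; split=> [x Ux|v].
  exact: near_eq_differentiable (open_near_eq Uo Ux fg) (fU x Ux).
apply: IHk (fk v) => x Ux.
by apply: near_eq_derive; apply: open_near_eq Ux fg.
Qed.

Lemma Ck_on_cst E F k (U : set E) (c : F) : Ck_on k U (fun=> c).
Proof.
elim: k c => [|k IHk] c /=; first by move=> x _; apply: cst_continuous.
split=> [x _|v]; first exact: differentiable_cst.
have -> : 'D_v (fun _ : E => c) = fun=> 0.
  by apply/funext => x; apply: derive_cst.
exact: IHk.
Qed.

Lemma Ck_onD E F k (U : set E) (f g : E -> F) : open U ->
  Ck_on k U f -> Ck_on k U g -> Ck_on k U (fun x => f x + g x).
Proof.
move=> Uo; elim: k f g => [|k IHk] f g /=.
  by move=> fU gU x Ux; apply: continuousD; [apply: fU|apply: gU].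
move=> [fU fk] [gU gk]; have fgd x : U x -> is_diff x (fun x => f x + g x)
    (fun v => 'd f x v + 'd g x v).
  by move=> Ux; apply: is_diffD; apply: differentiableP; [apply: fU|apply: gU].
split=> [x Ux|v]; first by case: (fgd x Ux).
apply: Ck_on_eq (IHk _ _ (fk v) (gk v)) => // x Ux.
case: (fgd x Ux) => d dE; rewrite [RHS]deriveE // dE.
by rewrite !deriveE //; [apply: gU|apply: fU].
Qed.

Lemma Ck_onZ E F k (U : set E) (f : E -> R) (g : E -> F) : open U ->
  Ck_on k U f -> Ck_on k U g -> Ck_on k U (fun x => f x *: g x).
Proof.
move=> Uo; elim: k f g => [|k IHk] f g.
  by move=> fU gU x Ux; apply: continuousZ; [apply: fU|apply: gU].
(* Each Leibniz term keeps one factor undifferentiated, and the induction hypothesis needs that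
   factor at order k only. *)
move=> fk1 gk1; have fk0 := Ck_onW fk1; have gk0 := Ck_onW gk1.
case: fk1 gk1 => [fU fk] [gU gk].
have fgd x : U x -> is_diff x (fun x => f x *: g x)
    (fun v => 'd f x v *: g x + f x *: 'd g x v).
  move=> Ux; apply: is_diffZ_vec; apply: differentiableP.
    exact: fU.
  exact: gU.
split=> [x Ux|v]; first by case: (fgd x Ux).
have h := Ck_onD Uo (IHk _ _ (fk v) gk0) (IHk _ _ fk0 (gk v)).
apply: Ck_on_eq h => // x Ux.
case: (fgd x Ux) => d dE; rewrite [RHS]deriveE // dE.
by rewrite !deriveE //; [apply: gU|apply: fU].
Qed.

Lemma Ck_on_lin E F G k (U : set E) (f : E -> F) (l : {linear F -> G}) :
  open U -> continuous l -> Ck_on k U f -> Ck_on k U (l \o f).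
Proof.
move=> Uo lc; elim: k f => [|k IHk] f.
  by move=> fU x Ux; apply: continuous_comp; [apply: fU|apply: lc].
move=> [fU fk]; have lf x : U x -> is_diff x (l \o f) (l \o 'd f x).
  move=> Ux; apply: is_diff_comp; first exact/differentiableP/fU.
  exact: is_diff_linear.
split=> [x Ux|v]; first by case: (lf x Ux).
apply: Ck_on_eq (IHk _ (fk v)) => // x Ux.
case: (lf x Ux) => d dE; rewrite [RHS]deriveE // dE /=.
by rewrite !deriveE //; apply: fU.
Qed.

Lemma Ck_on_sum E F (I : finType) k (U : set E) (f : I -> E -> F) : open U ->
  (forall i, Ck_on k U (f i)) -> Ck_on k U (fun x => \sum_i f i x).
Proof.
move=> Uo fk.
have -> : (fun y => \sum_i f i y) = \sum_i f i.
  by apply/funext => y; rewrite fct_sumE.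
elim/big_ind: _ => // [|f1 f2 h1 h2]; first exact: Ck_on_cst.
exact: Ck_onD.
Qed.

(** The chain rule gives 'd f (g x) applied to the moving vector D_v g. Expanding this vector in the
    basis leaves derivatives of f in fixed directions, to which the induction hypothesis applies. *)
Lemma Ck_on_comp D E F (B : lin_basis E) k (U : set D) (V : set E)
  (g : D -> E) (f : E -> F) : open U -> (forall x, U x -> V (g x)) ->
  Ck_on k U g -> Ck_on k V f -> Ck_on k U (f \o g).
Proof.
move=> Uo UV; elim: k f g UV => [|k IHk] f g UV.
  by move=> gU fV x Ux; apply: continuous_comp; [apply: gU|apply/fV/UV].
move=> gk1 fk1; have gk0 := Ck_onW gk1; case: gk1 fk1 => [gU gk] [fV fk].
have fg x : U x -> is_diff x (f \o g) ('d f (g x) \o 'd g x).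
  by move=> Ux; apply: is_diff_comp; apply: differentiableP; [apply: gU|apply/fV/UV].
split=> [x Ux|v]; first by case: (fg x Ux).
have h j := Ck_onZ Uo (Ck_on_lin Uo (bco_continuous B j) (gk v))
  (IHk _ _ UV gk0 (fk (bvec B j))).
apply: Ck_on_eq (Ck_on_sum Uo h) => // x Ux.
case: (fg x Ux) => d dE; rewrite [RHS]deriveE // dE /=.
rewrite [in RHS](bcoE B ('d g x v)) linear_sum.
apply: eq_bigr => j _; rewrite linearZ /=.
by rewrite !deriveE //; [apply/fV/UV|apply: gU].
Qed.

Lemma smooth_on_differentiable E F (U : set E) (f : E -> F) x :
  smooth_on U f -> U x -> differentiable f x.
Proof. by move=> fU Ux; have [fd _] := fU 1%N; exact: fd. Qed.

Lemma smooth_on_derive E F (U : set E) (f : E -> F) v :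
  smooth_on U f -> smooth_on U ('D_v f).
Proof. by move=> fU k; have [_ fk] := fU k.+1; exact: fk. Qed.

End Ck.

(** * Symmetry of second derivatives *)

Section Schwarz.
Context {R : realType} {E : normedModType R}.

Lemma is_derive_line (f : E -> R) (U : set E) (p v : E) (t : R) :
  (forall x, U x -> differentiable f x) -> U (p + t *: v) ->
  is_derive t 1 (fun s : R => f (p + s *: v)) ('D_v f (p + t *: v)).
Proof.
move=> fU Ut; rewrite deriveE; last exact: fU.
have dl : is_diff t (fun s : R => p + s *: v) (fun s => 0 + s *: v).
  exact: (is_diffD (is_diff_cst p t) (is_diff_scalel t v)).
have d : is_diff t (fun s : R => f (p + s *: v))
   ('d f (p + t *: v) \o (fun s => 0 + s *: v)).
  exact: (is_diff_comp dl (differentiableP (fU _ Ut))).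
case: d => d dE; apply: DeriveDef; first exact: diff_derivable.
by rewrite deriveE // dE /= scale1r add0r.
Qed.

(** Two uses of the mean value theorem: along v for the increment [phi] of f in the direction h w,
    then along w for D_v f. *)
Lemma second_difference (f : E -> R) (U : set E) (x v w : E) (h : R) :
  0 < h ->
  (forall y, U y -> differentiable f y) ->
  (forall y, U y -> differentiable ('D_v f) y) ->
  (forall s t, 0 <= s <= h -> 0 <= t <= h -> U (x + s *: v + t *: w)) ->
  exists s t, [/\ 0 <= s <= h, 0 <= t <= h &
   f (x + h *: v + h *: w) - f (x + h *: v) - f (x + h *: w) + f x =
     'D_w ('D_v f) (x + s *: v + t *: w) * h ^+ 2].
Proof.
move=> h0 fU dfU Ust.
have hh : 0 <= h <= h by apply/andP; split=> //; exact: ltW.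
have h00 : 0 <= (0 : R) <= h by apply/andP; split=> //; exact: ltW.
pose phi s := f (x + h *: w + s *: v) - f (x + s *: v).
have dphi s : 0 <= s <= h -> is_derive s 1 phi
    ('D_v f (x + h *: w + s *: v) - 'D_v f (x + s *: v)).
  move=> sh; apply: is_deriveB; apply: is_derive_line fU _.
    by rewrite addrAC; apply: Ust.
  by have := Ust s 0 sh h00; rewrite scale0r addr0.
have [s0||s sh sE] := @MVT_segment R phi
   (fun s => 'D_v f (x + h *: w + s *: v) - 'D_v f (x + s *: v)) 0 h (ltW h0).
- by rewrite in_itv /= => /andP[? ?]; apply: dphi; rewrite !ltW.
- apply: derivable_within_continuous => s0; rewrite in_itv /= => s0h.
  by case: (dphi s0 s0h).
have {}sh : 0 <= s <= h by move: sh; rewrite in_itv.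
have dpsi t : 0 <= t <= h ->
    is_derive t 1 (fun t : R => 'D_v f (x + s *: v + t *: w))
      ('D_w ('D_v f) (x + s *: v + t *: w)).
  by move=> th; apply: is_derive_line dfU _; apply: Ust.
have [t0||t th tE] := @MVT_segment R (fun t : R => 'D_v f (x + s *: v + t *: w))
   (fun t => 'D_w ('D_v f) (x + s *: v + t *: w)) 0 h (ltW h0).
- by rewrite in_itv /= => /andP[? ?]; apply: dpsi; rewrite !ltW.
- apply: derivable_within_continuous => t0; rewrite in_itv /= => t0h.
  by case: (dpsi t0 t0h).
have {}th : 0 <= t <= h by move: th; rewrite in_itv.
exists s, t; split=> //.
move: sE tE; rewrite /phi !scale0r !addr0 !subr0 => sE tE.
rewrite expr2 mulrA -tE [x + s *: v + h *: w]addrAC -sE.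
by rewrite [x + h *: v + _]addrAC; ring.
Qed.

(* Both mixed derivatives are limits of the same second difference quotient. *)
Lemma Schwarz_real (f : E -> R) (U : set E) x v w :
  open U -> U x -> Ck_on 2 U f -> 'D_v ('D_w f) x = 'D_w ('D_v f) x.
Proof.
move=> Uo Ux [fU f2].
(* Exchanging a and b leaves the quotient unchanged but exchanges the order of differentiation. Both
   mixed derivatives are then within e / 2 of the quotient for one common h. *)
suff main (a b : E) (e : R) : 0 < e -> \forall h \near (0 : R)^'+,
  `|(f (x + h *: a + h *: b) - f (x + h *: a) - f (x + h *: b) + f x) / h ^+ 2
    - 'D_b ('D_a f) x| < e.
  apply/eqP; rewrite -subr_eq0 -normr_le0; apply/ler_addgt0Pr => e e0.
  rewrite add0r.
  have e2 : 0 < e / 2 by rewrite divr_gt0.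
  have [h [h1 h2]] := filter_ex (filterI (main v w _ e2) (main w v _ e2)).
  move: h2; rewrite [x + h *: w + _]addrAC.
  rewrite [f _ - f (x + h *: w) - _]addrAC => h2.
  move: h1 h2; set q := (_ / _); rewrite [e in `|_| <= e]splitr.
  move: ('D_v _ _) ('D_w _ _) q => d1 d2 q h1 h2.
  rewrite -(subrKA q) (le_trans (ler_normD _ _)) //.
  by apply: lerD; apply: ltW; first rewrite distrC.
move=> e0.
have [fa fab] := f2 a; have cab := fab b x Ux.
have : \forall y \near x, U y /\ `|'D_b ('D_a f) y - 'D_b ('D_a f) x| < e.
  near=> y; split; first by near: y; exact: open_nbhs_nbhs.
  by near: y; move/cvgrPdistC_lt : cab; apply.
move=> /nbhs_ballP[_ /posnumP[r] xr].
near=> h.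
have h0 : 0 < h by near: h; exact: nbhs_right_gt.
have hr : h * (`|a| + `|b|) < r%:num.
  (* The summand 1 keeps the divisor positive when a and b both vanish. *)
  have ab0 : 0 < `|a| + `|b| + 1 by rewrite ltr_wpDl // addr_ge0.
  apply: (@le_lt_trans _ _ (h * (`|a| + `|b| + 1))).
    by apply: ler_wpM2l; [exact: ltW|rewrite lerDl].
  rewrite -ltr_pdivlMr //; near: h; apply: nbhs_right_lt.
have bst s t : 0 <= s <= h -> 0 <= t <= h -> ball x r%:num (x + s *: a + t *: b).
  move=> /andP[s0 sh] /andP[t0 th].
  rewrite -ball_normE /= -addrA opprD addrA subrr add0r normrN.
  apply: le_lt_trans hr; rewrite mulrDr (le_trans (ler_normD _ _)) //.
  by rewrite !normrZ !ger0_norm // lerD // ler_wpM2r.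
have [s [t [sh th ->]]] := @second_difference f (ball x r%:num) x a b h h0
   (fun y yr => fU y (xr y yr).1) (fun y yr => fa y (xr y yr).1) bst.
rewrite mulfK ?expf_neq0 ?gt_eqF //.
by have [] := xr _ (bst s t sh th).
Unshelve. all: by end_near. Qed.

End Schwarz.

Section SchwarzVec.
Context {R : realType} {E F : normedModType R}.

(** The mean value theorem is scalar, so the equality is tested on the coordinate functionals of the
    target, which commute with directional derivatives. *)
Lemma Schwarz (B : lin_basis F) (f : E -> F) (U : set E) x v w :
  open U -> U x -> smooth_on U f -> 'D_v ('D_w f) x = 'D_w ('D_v f) x.
Proof.
move=> Uo Ux fU.
have fdif y : U y -> differentiable f y by exact: smooth_on_differentiable.
have ddif a y : U y -> differentiable ('D_a f) y.
  by move=> Uy; apply: smooth_on_differentiable Uy; apply: smooth_on_derive.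
have lD (g : E -> F) j a y : differentiable g y ->
    'D_a (bco B j \o g) y = bco B j ('D_a g y).
  move=> gd.
  have : is_diff y (bco B j \o g) (bco B j \o 'd g y).
    apply: is_diff_comp; first exact/differentiableP.
    by apply: is_diff_linear; apply: bco_continuous.
  by case=> d dE; rewrite deriveE // dE /= deriveE.
rewrite (bcoE B ('D_v _ x)) (bcoE B ('D_w _ x)).
apply: eq_bigr => j _; congr (_ *: _).
rewrite -!lD //; try exact: ddif.
have := Schwarz_real v w Uo Ux (Ck_on_lin Uo (bco_continuous B j) (fU 2%N)).
have dE a b : 'D_a ('D_b (bco B j \o f)) x = 'D_a (bco B j \o 'D_b f) x.
  apply: near_eq_derive; apply: open_near_eq Ux _ => // y Uy.
  by apply: lD; apply: fdif.
by rewrite !dE.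
Qed.

End SchwarzVec.

(** * Charts *)

Section Charts.
Context {R : realType} {E : normedModType R} (B : lin_basis E) {A : atlas E}.
Hypothesis hA : smooth_atlas A.
Implicit Types (i j k : idx A) (p q : pt A) (W : set (pt A)) (b v : E).

Local Notation img i W := (chart i @` (dom i `&` W)).

Lemma imgP i W x : img i W x ->
  [/\ dom i (param i x), W (param i x) & chart i (param i x) = x].
Proof. by move=> [p [ip Wp] <-]; rewrite chartK. Qed.

Lemma img_chart i W p : dom i p -> W p -> img i W (chart i p).
Proof. by move=> ip Wp; exists p. Qed.

Lemma aopenI W W' : aopen W -> aopen W' -> aopen (W `&` W').
Proof.
move=> Wo W'o i.
have -> : img i (W `&` W') = img i W `&` img i W'.
  rewrite eqEsubset; split=> [_ [p [ip [Wp W'p]] <-]|x].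
    by split; apply: img_chart.
  move=> [/imgP[ip Wp xE] /imgP[_ W'p _]].
  by exists (param i x).
exact: openI.
Qed.

Lemma aopen_dom i : aopen (dom i).
Proof. by move=> j; apply: overlap_open. Qed.

Lemma img_open i W : aopen W -> open (img i W).
Proof. by move=> Wo; apply: Wo. Qed.

Lemma near_chart (F : normedModType R) i W (f g : E -> F) p :
  aopen W -> W p -> dom i p ->
  (forall q, dom i q -> W q -> f (chart i q) = g (chart i q)) ->
  {near chart i p, f =1 g}.
Proof.
move=> Wo Wp ip fg.
apply: (open_near_eq (img_open i Wo)) => [|_ [q [iq Wq] <-]].
  exact: img_chart.
exact: fg.
Qed.

Lemma trans_chart i j p : dom i p -> trans i j (chart i p) = chart j p.
Proof. by move=> ip; rewrite /trans chartK. Qed.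

Lemma trans_differentiable i j p : dom i p -> dom j p ->
  differentiable (trans i j) (chart i p).
Proof.
move=> ip jp; apply: smooth_on_differentiable (trans_smooth hA i j) _.
exact: img_chart.
Qed.

(** The cocycle identity of the transition maps holds near the point and is differentiated there.
    All change-of-chart rules for tangent vectors follow from it. *)
Lemma diff_trans_comp i j k p v : dom i p -> dom j p -> dom k p ->
  'd (trans j k) (chart j p) ('d (trans i j) (chart i p) v) =
  'd (trans i k) (chart i p) v.
Proof.
move=> ip jp kp.
have jk : differentiable (trans j k) (trans i j (chart i p)).
  by rewrite trans_chart //; apply: trans_differentiable.
have ij := trans_differentiable ip jp.
have h : {near chart i p, trans j k \o trans i j =1 trans i k}.
  apply: (near_chart (aopen_dom j)) => // q iq jq /=.
  by rewrite !trans_chart.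
have := near_eq_diff h (differentiable_comp ij jk).
by rewrite diff_comp // trans_chart // => ->.
Qed.

Lemma diff_trans_id i p v : dom i p -> 'd (trans i i) (chart i p) v = v.
Proof.
move=> ip; have h : {near chart i p, id =1 trans i i}.
  by apply: (near_chart (aopen_dom i)) => // q iq _; rewrite trans_chart.
by case: (near_eq_is_diff h (is_diff_id _)) => _ ->.
Qed.

Lemma coord_vec i p b : dom i p -> coord i p (vec i b p) = b.
Proof.
by move=> ip; rewrite /coord /vec diff_trans_comp ?diff_trans_id //;
  apply: chart_at_dom.
Qed.

Lemma vec_coord i p v : dom i p -> vec i (coord i p v) p = v.
Proof.
by move=> ip; rewrite /coord /vec diff_trans_comp ?diff_trans_id //;
  apply: chart_at_dom.
Qed.

Lemma coord_chart_at p v : coord (chart_at p) p v = v.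
Proof. by rewrite /coord diff_trans_id //; apply: chart_at_dom. Qed.

Lemma vec_chart_at p v : vec (chart_at p) v p = v.
Proof. by rewrite /vec diff_trans_id //; apply: chart_at_dom. Qed.

Lemma coord_trans i j p v : dom i p -> dom j p ->
  coord j p v = 'd (trans i j) (chart i p) (coord i p v).
Proof.
by move=> ip jp; rewrite /coord diff_trans_comp //; apply: chart_at_dom.
Qed.

Lemma coord_vec_trans i j p b : dom i p -> dom j p ->
  coord j p (vec i b p) = 'd (trans i j) (chart i p) b.
Proof. by move=> ip jp; rewrite (coord_trans _ ip) // coord_vec. Qed.

Lemma coordD i p u v : coord i p (u + v) = coord i p u + coord i p v.
Proof. exact: linearD. Qed.

Lemma coordZ i p a v : coord i p (a *: v) = a *: coord i p v.
Proof. exact: linearZ. Qed.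

Lemma vecD i p u v : vec i (u + v) p = vec i u p + vec i v p.
Proof. exact: linearD. Qed.

Lemma vecZ i p a v : vec i (a *: v) p = a *: vec i v p.
Proof. exact: linearZ. Qed.

Lemma in_chartE i p (X : pt A -> E) : dom i p ->
  in_chart i X (chart i p) = coord i p (X p).
Proof. by move=> ip; rewrite /in_chart chartK. Qed.

Lemma smooth_vfS W W' (X : pt A -> E) : W' `<=` W -> smooth_vf W X -> smooth_vf W' X.
Proof.
move=> W'W WX i k; apply: Ck_on_sub (WX i k).
by move=> _ [p [ip W'p] <-]; apply: img_chart => //; apply: W'W.
Qed.

(** The definition of [vec] uses a preferred chart that varies with the point. Read in a fixed chart
    j, the field is D_b (trans i j) composed with [trans j i], in which the preferred chart no
    longer occurs. *)
Lemma smooth_vf_vec i b : smooth_vf (dom i) (vec i b).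
Proof.
move=> j k.
have h : Ck_on k (img j (dom i)) ('D_b (trans i j) \o trans j i).
  apply: (Ck_on_comp B (V := img i (dom j))).
  - exact/img_open/aopen_dom.
  - move=> _ [p [jp ip] <-]; rewrite trans_chart //; exact: img_chart.
  - exact: trans_smooth.
  - by apply: smooth_on_derive; apply: trans_smooth.
apply: Ck_on_eq h; first exact/img_open/aopen_dom.
move=> _ [p [jp ip] <-] /=; rewrite in_chartE // (coord_vec_trans _ ip jp).
by rewrite trans_chart // deriveE //; apply: trans_differentiable.
Qed.

Lemma smooth_fun_chart i W (f : pt A -> R) : aopen W -> W `<=` dom i ->
  smooth_on (img i W) (f \o param i) -> smooth_fun W f.
Proof.
move=> Wo Wi fi j k.
have h : Ck_on k (img j W) ((f \o param i) \o trans j i).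
  apply: (Ck_on_comp B (V := img i W)).
  - exact: img_open.
  - move=> _ [p [jp Wp] <-]; rewrite trans_chart //.
    by apply: img_chart => //; apply: Wi.
  - apply: Ck_on_sub (trans_smooth hA j i k).
    by move=> _ [p [jp Wp] <-]; apply: img_chart => //; apply: Wi.
  - exact: fi.
apply: Ck_on_eq h; first exact: img_open.
move=> _ [p [jp Wp] <-] /=; rewrite trans_chart // !chartK //; exact: Wi.
Qed.

Lemma smooth_fun_bco i W (X : pt A -> E) (m : bidx B) : aopen W -> W `<=` dom i ->
  smooth_vf W X -> smooth_fun W (fun q => bco B m (coord i q (X q))).
Proof.
move=> Wo Wi WX; apply: (smooth_fun_chart Wo Wi) => k.
exact: (Ck_on_lin (img_open _ Wo) (bco_continuous B m) (WX i k)).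
Qed.

Lemma smooth_vfD W (X Y : pt A -> E) : aopen W -> smooth_vf W X ->
  smooth_vf W Y -> smooth_vf W (fun q => X q + Y q).
Proof.
move=> Wo WX WY i k.
have := Ck_onD (img_open _ Wo) (WX i k) (WY i k).
apply: Ck_on_eq; first exact: img_open.
by move=> x _; rewrite /in_chart coordD.
Qed.

Lemma smooth_vfZ W (f : pt A -> R) (Y : pt A -> E) : aopen W -> smooth_fun W f ->
  smooth_vf W Y -> smooth_vf W (fun q => f q *: Y q).
Proof.
move=> Wo Wf WY i k.
have := Ck_onZ (img_open _ Wo) (Wf i k) (WY i k).
apply: Ck_on_eq; first exact: img_open.
by move=> x _; rewrite /in_chart coordZ.
Qed.

Lemma smooth_vf0 W : smooth_vf W (fun=> 0 : E).
Proof.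
move=> i k.
have -> : in_chart i (fun=> 0) = fun=> 0.
  by apply/funext => x; rewrite /in_chart /coord linear0.
exact: Ck_on_cst.
Qed.

Lemma in_chart_differentiable i W (X : pt A -> E) p : smooth_vf W X -> W p ->
  dom i p -> differentiable (in_chart i X) (chart i p).
Proof.
move=> WX Wp ip; apply: smooth_on_differentiable (WX i) _; exact: img_chart.
Qed.

Lemma vder_chart i p v (f : pt A -> R) : dom i p ->
  differentiable (f \o param i) (chart i p) ->
  vder p v f = 'd (f \o param i) (chart i p) (coord i p v).
Proof.
move=> ip fd; rewrite /vder; set j := chart_at p.
have jp : dom j p by exact: chart_at_dom.
have h : {near chart j p, (f \o param i) \o trans j i =1 f \o param j}.
  apply: (near_chart (aopen_dom i)) => // q jq iq /=.
  by rewrite trans_chart // !chartK.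
have ji := trans_differentiable jp ip.
have fi : differentiable (f \o param i) (trans j i (chart j p)).
  by rewrite trans_chart.
have := near_eq_diff h (differentiable_comp ji fi).
by rewrite diff_comp // trans_chart // => ->.
Qed.

End Charts.

(** * Bilinear maps depending on a parameter *)

Section BilinearParam.
Context {R : realType} {D P E F : normedModType R} (B : lin_basis E).
Variables (beta : P -> E -> E -> F) (U : set P).
Hypothesis Uo : open U.
Hypothesis betal : forall x, U x -> forall c u v w,
  beta x (c *: u + v) w = c *: beta x u w + beta x v w.
Hypothesis betar : forall x, U x -> forall c u v w,
  beta x w (c *: u + v) = c *: beta x w u + beta x w v.

Let betal_sum x (U_x : U x) (I : finType) (f : I -> R) (e : I -> E) w :
  beta x (\sum_i f i *: e i) w = \sum_i f i *: beta x (e i) w.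
Proof.
have b0 : beta x 0 w = 0.
  have := betal U_x 1 0 0 w; rewrite !scale1r addr0 => /esym.
  by move/(congr1 (fun y => y - beta x 0 w)); rewrite addrK subrr.
by elim/big_rec2: _ => [//|i y1 y2 _ <-]; rewrite betal.
Qed.

Let betar_sum x (U_x : U x) (I : finType) (f : I -> R) (e : I -> E) w :
  beta x w (\sum_i f i *: e i) = \sum_i f i *: beta x w (e i).
Proof.
have b0 : beta x w 0 = 0.
  have := betar U_x 1 0 0 w; rewrite !scale1r addr0 => /esym.
  by move/(congr1 (fun y => y - beta x w 0)); rewrite addrK subrr.
by elim/big_rec2: _ => [//|i y1 y2 _ <-]; rewrite betar.
Qed.

Let betaE x u v : U x -> beta x u v =
  \sum_k \sum_l bco B k u *: (bco B l v *: beta x (bvec B k) (bvec B l)).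
Proof.
move=> Ux; rewrite {1}(bcoE B u) betal_sum //; apply: eq_bigr => k _.
rewrite {1}(bcoE B v) betar_sum // scaler_sumr.
by apply: eq_bigr.
Qed.

(** Serves both the Christoffel symbols and the metric coefficients. In a basis, beta becomes a
    finite sum of products of coordinates of a and b with functions of the parameter alone, and the
    three terms are the three factors of the Leibniz rule. *)
Lemma is_diff_bilinear_param (h : D -> P) (a b : D -> E) z dh da db :
  U (h z) -> (forall u v, differentiable (beta ^~ u ^~ v) (h z)) ->
  is_diff z h dh -> is_diff z a da -> is_diff z b db ->
  is_diff z (fun y => beta (h y) (a y) (b y))
    (fun t => 'd (beta ^~ (a z) ^~ (b z)) (h z) (dh t)
              + beta (h z) (da t) (b z) + beta (h z) (a z) (db t)).
Proof.
move=> Uz bd hd ad bbd.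
have bco_diff k (c : D -> E) dc : is_diff z c dc ->
    is_diff z (fun y => bco B k (c y)) (fun t => bco B k (dc t)).
  move=> cd; exact: (is_diff_comp cd (is_diff_linear _ (bco_continuous B k))).
pose e k l := beta ^~ (bvec B k) ^~ (bvec B l).
have ed k l : is_diff z (fun y => e k l (h y)) (fun t => 'd (e k l) (h z) (dh t)).
  exact: (is_diff_comp hd (differentiableP (bd _ _))).
have main := is_diff_big (fun k => is_diff_big (fun l =>
  is_diffZ_vec (bco_diff k a da ad)
    (is_diffZ_vec (bco_diff l b db bbd) (ed k l)))).
have hU : \forall y \near z, U (h y).
  have [/differentiable_continuous hc _] := hd.
  by apply: hc; apply: open_nbhs_nbhs.
have near_main : {near z, (fun y => \sum_k \sum_l
    bco B k (a y) *: (bco B l (b y) *: e k l (h y))) =1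
    (fun y => beta (h y) (a y) (b y))}.
  by apply: filterS hU => y Uy; rewrite betaE.
have [d dE] := near_eq_is_diff near_main main.
split=> //; rewrite dE; apply/funext => t.
(* The derivative in the parameter, with both arguments frozen at z, is expanded in the same basis
   so that the two sums match term by term. *)
have e0 : 'd (beta ^~ (a z) ^~ (b z)) (h z) = (fun s =>
    \sum_k \sum_l bco B k (a z) *: (bco B l (b z) *: 'd (e k l) (h z) s)) :> (P -> F).
  have := is_diff_big (fun k => is_diff_big (fun l =>
    is_diffZ_const (bco B k (a z)) (is_diffZ_const (bco B l (b z))
      (differentiableP (bd (bvec B k) (bvec B l)))))).
  have nn : {near h z, (fun x => \sum_k \sum_l
    bco B k (a z) *: (bco B l (b z) *: e k l x)) =1 beta ^~ (a z) ^~ (b z)}.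
    by apply: (open_near_eq Uo Uz) => y Uy; rewrite betaE.
  by move=> /(near_eq_is_diff nn) [_ ->].
rewrite e0 (betaE (da t)) // (betaE (a z)) // -!big_split /=.
apply: eq_bigr => k _; rewrite -!big_split /=; apply: eq_bigr => l _.
by rewrite -/(e k l) scalerDr addrA addrC addrA.
Qed.

Lemma Ck_on_bilinear_param (C : lin_basis P) k (V : set D) (h : D -> P)
    (a b : D -> E) : open V -> (forall z, V z -> U (h z)) ->
  (forall u v, Ck_on k U (beta ^~ u ^~ v)) ->
  Ck_on k V h -> Ck_on k V a -> Ck_on k V b ->
  Ck_on k V (fun y => beta (h y) (a y) (b y)).
Proof.
move=> Vo VU bk hk ak bbk.
apply: (Ck_on_eq (f := fun y => \sum_k \sum_l
    bco B k (a y) *: (bco B l (b y) *: beta (h y) (bvec B k) (bvec B l)))) => //.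
  by move=> x Vx; rewrite -betaE //; apply: VU.
apply: Ck_on_sum => // m; apply: Ck_on_sum => // l.
apply: Ck_onZ => //; first exact: (Ck_on_lin Vo (bco_continuous B m) ak).
apply: Ck_onZ => //; first exact: (Ck_on_lin Vo (bco_continuous B l) bbk).
exact: (Ck_on_comp C Vo VU hk (bk (bvec B m) (bvec B l))).
Qed.

End BilinearParam.

(** * Connections in charts *)

Section Christoffel.
Context {R : realType} {E : normedModType R} (B : lin_basis E) {A : atlas E}.
Hypothesis hA : smooth_atlas A.
Variable nabla : pt A -> E -> (pt A -> E) -> E.
Hypothesis hnabla : connection nabla.
Implicit Types (i j : idx A) (p q : pt A) (W : set (pt A)) (a b v : E).

Local Notation img i W := (chart i @` (dom i `&` W)).

Lemma conn0 W p v : aopen W -> W p -> nabla p v (fun=> 0) = 0.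
Proof.
move=> Wo Wp; have s0 := @smooth_vf0 _ _ A W.
have := conn_add hnabla v Wo Wp s0 s0.
have -> : (fun=> (0 : E) + 0) = (fun=> 0) :> (pt A -> E).
  by apply/funext => q; rewrite addr0.
by move/(congr1 (fun y => y - nabla p v (fun=> 0))); rewrite addrK subrr.
Qed.

Lemma conn_sum W p v (I : finType) (Y : I -> pt A -> E) : aopen W -> W p ->
  (forall k, smooth_vf W (Y k)) ->
  nabla p v (fun q => \sum_k Y k q) = \sum_k nabla p v (Y k) /\
  smooth_vf W (fun q => \sum_k Y k q).
Proof.
move=> Wo Wp WY.
elim: index_enum => [|k r [IHe IHs]].
  have -> : (fun q => \sum_(k <- [::]) Y k q) = fun=> 0.
    by apply/funext => q; rewrite big_nil.
  by rewrite big_nil (conn0 _ Wo Wp); split=> //; apply: smooth_vf0.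
have -> : (fun q => \sum_(k <- k :: r) Y k q) =
    fun q => Y k q + \sum_(k <- r) Y k q.
  by apply/funext => q; rewrite big_cons.
rewrite big_cons; split; last exact: smooth_vfD.
by rewrite (conn_add hnabla v Wo Wp) // IHe.
Qed.

(* [gam i x a b] is Gamma(a, b) in the chart i, at the point of coordinates x. *)
Definition gam i (x : E) (a b : E) : E :=
  in_chart i (fun p => nabla p (vec i a p) (vec i b)) x.

Lemma gamE i p a b : dom i p ->
  gam i (chart i p) a b = coord i p (nabla p (vec i a p) (vec i b)).
Proof. by move=> ip; rewrite /gam in_chartE. Qed.

Lemma gam_smooth i a b : smooth_on (img i (dom i)) (gam i ^~ a ^~ b).
Proof.
have := conn_smooth hnabla (aopen_dom hA i) (smooth_vf_vec B hA i a)
  (smooth_vf_vec B hA i b).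
exact.
Qed.

Lemma gam_linearl i p c u v w : dom i p ->
  gam i (chart i p) (c *: u + v) w =
  c *: gam i (chart i p) u w + gam i (chart i p) v w.
Proof.
move=> ip; rewrite !gamE // vecD vecZ.
rewrite (conn_linear hnabla _ _ _ (aopen_dom hA i) ip (smooth_vf_vec B hA i w)).
by rewrite coordD coordZ.
Qed.

Lemma gam_linearr i p c u v w : dom i p ->
  gam i (chart i p) w (c *: u + v) =
  c *: gam i (chart i p) w u + gam i (chart i p) w v.
Proof.
move=> ip; rewrite !gamE //.
have -> : vec i (c *: u + v) = fun q => c *: vec i u q + vec i v q.
  by apply/funext => q; rewrite vecD vecZ.
have io := aopen_dom hA i.
have cs : smooth_fun (dom i) (fun=> c) by move=> j k; apply: Ck_on_cst.
have us := smooth_vf_vec B hA i u.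
rewrite (conn_add hnabla _ io ip (smooth_vfZ io cs us)); last exact: smooth_vf_vec.
rewrite (conn_leibniz hnabla _ io ip cs us).
have -> : vder p (vec i w p) (fun=> c) = 0.
  by rewrite /vder; have -> := diff_cst c (chart (chart_at p) p).
by rewrite scale0r add0r coordD coordZ.
Qed.

(** In a chart, nabla is d + Gamma: near p, Y is a combination of coordinate fields, and the Leibniz
    rule separates the derivatives of its components from the derivatives of these fields. Locality
    allows Y to be replaced by this combination on [W] intersected with the chart domain. *)
Lemma conn_coord i W p v (Y : pt A -> E) : aopen W -> W p -> smooth_vf W Y ->
  dom i p ->
  coord i p (nabla p v Y) = 'd (in_chart i Y) (chart i p) (coord i p v)
    + gam i (chart i p) (coord i p v) (coord i p (Y p)).
Proof.
move=> Wo Wp WY ip.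
have Wio := aopenI hA Wo (aopen_dom hA i).
have Wip : (W `&` dom i) p by [].
have WiY : smooth_vf (W `&` dom i) Y by apply: smooth_vfS WY => q [].
pose f k q := bco B k (coord i q (Y q)).
have fs k : smooth_fun (W `&` dom i) (f k).
  by apply: (smooth_fun_bco hA) => // q [].
have vs k : smooth_vf (W `&` dom i) (vec i (bvec B k)).
  by apply: smooth_vfS (smooth_vf_vec B hA i (bvec B k)) => q [].
have [sumE sums] := @conn_sum _ p v _ (fun k q => f k q *: vec i (bvec B k) q)
  Wio Wip (fun k => smooth_vfZ Wio (fs k) (vs k)).
have YE q : (W `&` dom i) q -> Y q = \sum_k f k q *: vec i (bvec B k) q.
  move=> [_ iq]; rewrite -[LHS](vec_coord hA _ iq) {1}(bcoE B (coord i q (Y q))).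
  by rewrite /vec linear_sum; apply: eq_bigr => k _; rewrite linearZ.
rewrite (conn_local hnabla v Wio Wip WiY sums YE) sumE.
have Yd := in_chart_differentiable WY Wp ip.
have fd k : is_diff (chart i p) (f k \o param i)
    (bco B k \o 'd (in_chart i Y) (chart i p)).
  exact: (is_diff_comp (differentiableP Yd) (is_diff_linear _ (bco_continuous B k))).
have lc (I : finType) (X : I -> E) : coord i p (\sum_k X k) = \sum_k coord i p (X k).
  exact: linear_sum.
rewrite lc [X in X + _](bcoE B) [X in gam _ _ _ X](bcoE B).
have -> c (I : finType) (X : I -> E) (g : I -> R) :
    gam i (chart i p) c (\sum_k g k *: X k) = \sum_k g k *: gam i (chart i p) c (X k).
  have b0 : gam i (chart i p) c 0 = 0.
    have := gam_linearr 1 0 0 c ip; rewrite !scale1r addr0 => /esym.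
    by move/(congr1 (fun y => y - gam i (chart i p) c 0)); rewrite addrK subrr.
  by elim/big_rec2: _ => [//|k y1 y2 _ <-]; rewrite gam_linearr.
rewrite -big_split /=; apply: eq_bigr => k _.
rewrite (conn_leibniz hnabla _ Wio Wip (fs k) (vs k)) coordD !coordZ coord_vec //.
case: (fd k) => d dE; rewrite (vder_chart hA _ ip d) dE /=; congr (_ + _).
by rewrite gamE // vec_coord.
Qed.

Lemma gam_chart_at p a b :
  gam (chart_at p) (chart (chart_at p) p) a b = nabla p a (vec (chart_at p) b).
Proof.
have ip := chart_at_dom hA p.
by rewrite gamE // coord_chart_at // vec_chart_at.
Qed.

Lemma in_chart_vec i p b : dom i p ->
  {near chart i p, (fun=> b) =1 in_chart i (vec i b)}.
Proof.
move=> ip; apply: (near_chart (aopen_dom hA i)) => // q iq _.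
by rewrite in_chartE // coord_vec.
Qed.

(** In their own chart, coordinate fields have constant components near p, so both differentials
    vanish. *)
Lemma lie_vec p a b : lie (vec (chart_at p) a) (vec (chart_at p) b) p = 0.
Proof.
have ip := chart_at_dom hA p.
have h c := near_eq_is_diff (in_chart_vec c ip) (is_diff_cst c _).
rewrite /lie; case: (h a) (h b) => _ -> [_ ->].
by rewrite subr0.
Qed.

Section Flat.
Hypothesis hflat : flat nabla.

(** R = 0 evaluated on coordinate fields. Their bracket is zero, so the two second covariant
    derivatives agree, and [conn_coord] expands each one. *)
Lemma gam_flat p a b c :
  let i := chart_at p in let x := chart i p in
  'd (gam i ^~ b ^~ c) x a + gam i x a (gam i x b c) =
  'd (gam i ^~ a ^~ c) x b + gam i x b (gam i x a c).
Proof.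
move=> i x; have ip : dom i p := chart_at_dom hA p.
have io := aopen_dom hA i; have vs b := smooth_vf_vec B hA i b.
have := hflat io ip (vs a) (vs b) (vs c).
rewrite /curvature lie_vec.
have -> : nabla p 0 (vec i c) = 0.
  have := conn_linear hnabla 1 0 0 io ip (vs c); rewrite !scale1r addr0 => /esym.
  by move/(congr1 (fun y => y - nabla p 0 (vec i c))); rewrite addrK subrr.
rewrite subr0 => /subr0_eq /(congr1 (coord i p)).
rewrite !(conn_coord _ io ip (conn_smooth hnabla io (vs _) (vs _)) ip).
by rewrite !coord_vec // -!gamE.
Qed.
End Flat.

End Christoffel.

(** * Calculus on products, and differentiation of a differential *)

Section ProductCalculus.
Context {R : realType}.
Implicit Types D E F : normedModType R.

Lemma Ck_on_linear E F k (U : set E) (l : {linear E -> F}) :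
  open U -> continuous l -> Ck_on k U l.
Proof.
move=> Uo lc; case: k => [|k] /=; first by move=> x _; apply: lc.
split=> [x _|v]; first by case: (is_diff_linear x lc).
have -> : 'D_v l = fun=> l v.
  by apply/funext => x; have [d dE] := is_diff_linear x lc; rewrite deriveE // dE.
exact: Ck_on_cst.
Qed.

Lemma Ck_on_pair D E F k (U : set D) (f : D -> E) (g : D -> F) : open U ->
  Ck_on k U f -> Ck_on k U g -> Ck_on k U (fun x => (f x, g x)).
Proof.
move=> Uo; elim: k f g => [|k IHk] f g /=.
  by move=> fU gU x Ux; apply: cvg_pair; [apply: fU|apply: gU].
move=> [fU fk] [gU gk].
have fg x : U x -> is_diff x (fun x => (f x, g x)) (fun v => ('d f x v, 'd g x v)).
  by move=> Ux; apply: is_diff_pair; apply: differentiableP; [apply: fU|apply: gU].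
split=> [x Ux|v]; first by case: (fg x Ux).
apply: Ck_on_eq (IHk _ _ (fk v) (gk v)) => // x Ux.
case: (fg x Ux) => d dE; rewrite [RHS]deriveE // dE.
by rewrite !deriveE //; [apply: gU|apply: fU].
Qed.

Lemma fst_continuous E F : continuous (fst : E * F -> E).
Proof. by move=> x; apply: cvg_fst. Qed.

Lemma snd_continuous E F : continuous (snd : E * F -> F).
Proof. by move=> x; apply: cvg_snd. Qed.

Lemma is_diff_fst E F (z : E * F) : is_diff z fst fst.
Proof. exact: (is_diff_linear z (@fst_continuous E F)). Qed.

Lemma is_diff_snd E F (z : E * F) : is_diff z snd snd.
Proof. exact: (is_diff_linear z (@snd_continuous E F)). Qed.

Section PairBasis.
Context {E F : normedModType R} (B : lin_basis E) (C : lin_basis F).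

Let pvec (k : (bidx B + bidx C)%type) : E * F :=
  match k with inl i => (bvec B i, 0) | inr j => (0, bvec C j) end.

Let pco (k : (bidx B + bidx C)%type) : {linear (E * F)%type -> R} :=
  match k with inl i => bco B i \o fst | inr j => bco C j \o snd end.

Let pco_continuous k : continuous (pco k).
Proof.
case: k => k x /=; apply: continuous_comp.
- exact: fst_continuous.
- exact: bco_continuous.
- exact: snd_continuous.
- exact: bco_continuous.
Qed.

Let pcoE x : x = \sum_k pco k x *: pvec k.
Proof.
rewrite big_sumType /=; case: x => a b; apply/pair_equal_spec; split.
  rewrite !raddf_sum /= [X in _ + X]big1 ?addr0 -?(bcoE B a) // => j _.
  by rewrite scaler0.
rewrite !raddf_sum /= [X in X + _]big1 ?add0r -?(bcoE C b) // => j _.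
by rewrite scaler0.
Qed.

Definition pair_basis : lin_basis (E * F)%type := LinBasis pco_continuous pcoE.

End PairBasis.

End ProductCalculus.

Section DiffOfDiff.
Context {R : realType} {D E F : normedModType R} (B : lin_basis E).

Lemma diff_bcoE (f : E -> F) x v : differentiable f x ->
  'd f x v = \sum_k bco B k v *: 'D_(bvec B k) f x.
Proof.
move=> fd; rewrite {1}(bcoE B v) linear_sum; apply: eq_bigr => k _.
by rewrite linearZ deriveE.
Qed.

(** Both the base point and the direction of df move. Expanding the direction in a basis gives a
    term with the second derivative of f, the direction being frozen at [c z], and a term where the
    direction is differentiated. *)
Lemma is_diff_diff (f : E -> F) (U : set E) (h c : D -> E) z dh dc :
  open U -> U (h z) -> smooth_on U f -> is_diff z h dh -> is_diff z c dc ->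
  is_diff z (fun y => 'd f (h y) (c y))
    (fun t => 'd ('D_(c z) f) (h z) (dh t) + 'd f (h z) (dc t)).
Proof.
move=> Uo Uz fU hd cd.
have fd y : U y -> differentiable f y := smooth_on_differentiable fU.
have dfd v : differentiable ('D_v f) (h z).
  exact: smooth_on_differentiable (smooth_on_derive v fU) Uz.
have main := is_diff_big (fun k => is_diffZ_vec
  (is_diff_comp cd (is_diff_linear _ (bco_continuous B k)))
  (is_diff_comp hd (differentiableP (dfd (bvec B k))))).
have hU : \forall y \near z, U (h y).
  have [/differentiable_continuous hc _] := hd.
  by apply: hc; apply: open_nbhs_nbhs.
have nn : {near z, (fun y => \sum_k bco B k (c y) *: 'D_(bvec B k) f (h y)) =1
    (fun y => 'd f (h y) (c y))}.
  by apply: filterS hU => y Uy; rewrite -diff_bcoE //; apply: fd.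
have [d dE] := near_eq_is_diff nn main.
split=> //; rewrite dE; apply/funext => t /=.
rewrite big_split /= addrC; congr (_ + _); last by rewrite diff_bcoE //; apply: fd.
have := is_diff_big (fun k =>
  is_diffZ_const (bco B k (c z)) (differentiableP (dfd (bvec B k)))).
have n2 : {near h z, (fun x => \sum_k bco B k (c z) *: 'D_(bvec B k) f x)
    =1 'D_(c z) f}.
  apply: (open_near_eq Uo Uz) => x Ux.
  by rewrite -diff_bcoE ?deriveE //; apply: fd.
by case/(near_eq_is_diff n2) => _ /(congr1 (fun l : E -> F => l (dh t)))/esym.
Qed.

End DiffOfDiff.

(** * The tangent bundle *)

Section TangentBundle.
Context {R : realType} {E : normedModType R} (B : lin_basis E) {A : atlas E}.
Hypothesis hA : smooth_atlas A.
Implicit Types (i j : idx A) (p q : pt A) (P Q : pt (TM A)) (xi : E * E).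

Local Notation img i W := (chart i @` (dom i `&` W)).

Lemma TM_overlap i j :
  @chart _ _ (TM A) i @` (@dom _ _ (TM A) i `&` @dom _ _ (TM A) j) =
  [set z | img i (dom j) z.1].
Proof.
rewrite eqEsubset; split=> [_ [Q [iQ jQ] <-]|[x b] /= [p [ip jp] <-]].
  exact: (@img_chart _ _ A).
by exists (p, vec i b p) => //=; rewrite coord_vec.
Qed.

Lemma open_fst (D F : normedModType R) (U : set D) :
  open U -> open [set z : D * F | U z.1].
Proof. by move=> Uo; apply: open_comp => // z _; apply: fst_continuous. Qed.

Lemma diff_bco (i j : idx A) p b : dom i p -> dom j p ->
  'd (trans i j) (chart i p) b =
  \sum_k bco B k b *: 'D_(bvec B k) (trans i j) (chart i p).
Proof.
move=> ip jp; rewrite {1}(bcoE B b) linear_sum; apply: eq_bigr => k _.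
by rewrite linearZ deriveE //; apply: trans_differentiable.
Qed.

(** The transition map of TM, (x, b) |-> (tau x, d tau_x b), free of the preferred charts hidden in
    [vec] and [coord], and with d tau_x b written through derivatives in fixed directions so that
    its smoothness can be read off. It agrees with [trans] on the overlap. *)
Definition TMtrans i j (z : E * E) : E * E :=
  (trans i j z.1, \sum_k bco B k z.2 *: 'D_(bvec B k) (trans i j) z.1).

Lemma TM_transE i j z : img i (dom j) z.1 -> @trans _ _ (TM A) i j z = TMtrans i j z.
Proof.
case: z => x b /= [p [ip jp] <-]; rewrite /trans /TMtrans /=.
by rewrite chartK // (coord_vec_trans hA _ ip jp) diff_bco // /trans chartK.
Qed.

Lemma TMtrans_smooth i j : smooth_on [set z : E * E | img i (dom j) z.1] (TMtrans i j).
Proof.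
move=> k; have ijo := img_open i (aopen_dom hA j).
have Uo := open_fst (F := E) ijo.
have Cfst : Ck_on k [set z : E * E | img i (dom j) z.1] fst.
  exact: (Ck_on_linear _ Uo (@fst_continuous R E E)).
have Csnd : Ck_on k [set z : E * E | img i (dom j) z.1] snd.
  exact: (Ck_on_linear _ Uo (@snd_continuous R E E)).
apply: Ck_on_pair => //.
  apply: (Ck_on_comp B Uo _ Cfst (trans_smooth hA i j k)) => z; exact.
apply: Ck_on_sum => // l; apply: Ck_onZ => //.
  exact: (Ck_on_lin Uo (bco_continuous B l) Csnd).
apply: (Ck_on_comp B Uo _ Cfst (smooth_on_derive _ (trans_smooth hA i j) k)) => z; exact.
Qed.

Lemma TM_smooth_atlas : smooth_atlas (TM A).
Proof.
split.
- by move=> Q; exact: (chart_at_dom hA Q.1).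
- by move=> i [p u] /= ip; rewrite chartK // vec_coord.
- move=> i j; rewrite TM_overlap; apply: open_fst.
  exact: overlap_open.
- move=> i j k; rewrite TM_overlap.
  apply: Ck_on_eq (TMtrans_smooth i j k) => [|z hz].
    by apply: open_fst; apply: overlap_open.
  by rewrite TM_transE.
Qed.

(** The second component carries the second derivative of the transition map: fibre coordinates of
    vectors tangent to TM do not transform linearly by themselves. The Christoffel term of [vcomp]
    compensates for this. *)
Lemma is_diff_TMtrans i j p b : dom i p -> dom j p ->
  is_diff (chart i p, b) (TMtrans i j)
    (fun xi => ('d (trans i j) (chart i p) xi.1,
      'd (trans i j) (chart i p) xi.2
      + 'd ('D_b (trans i j)) (chart i p) xi.1)).
Proof.
move=> ip jp; set x := chart i p.
have ijs := trans_smooth hA i j.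
have ijx : img i (dom j) x by exact: img_chart.
have td := smooth_on_differentiable ijs ijx.
have ijo := img_open i (aopen_dom hA j).
have d1 := is_diff_comp (is_diff_fst (x, b)) (differentiableP td).
have d2 := is_diff_diff B (U := img i (dom j)) ijo ijx ijs
  (is_diff_fst (x, b)) (is_diff_snd (x, b)).
have nn : {near (x, b), (fun z : E * E => (trans i j z.1, 'd (trans i j) (z.1) z.2)) =1
    TMtrans i j}.
  apply: (open_near_eq (open_fst (F := E) ijo)) => // -[_ c] /= [p1 [ip1 jp1] <-].
  by rewrite /TMtrans /= diff_bco.
have [d dE] := near_eq_is_diff nn (is_diff_pair d1 d2).
split; first exact: d.
by apply: (etrans dE); apply/funext => xi /=; rewrite addrC.
Qed.

Lemma TM_coordE i Q xi : dom i Q.1 ->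
  let j := chart_at Q.1 in
  @Defs.coord _ _ (TM A) i Q xi =
  (coord i Q.1 xi.1,
   coord i Q.1 xi.2 + 'd ('D_(Q.2) (trans j i)) (chart j Q.1) xi.1).
Proof.
move=> iQ j; have jQ : dom j Q.1 by exact: chart_at_dom.
rewrite /Defs.coord /= coord_chart_at //.
have nn : {near (chart j Q.1, Q.2), TMtrans j i =1 @trans _ _ (TM A) j i}.
  apply: (open_near_eq (open_fst (F := E) (img_open j (aopen_dom hA i)))).
    exact: img_chart.
  by move=> z hz; rewrite TM_transE.
by have [_ ->] := near_eq_is_diff nn (is_diff_TMtrans Q.2 jQ iQ).
Qed.

Variable nabla : pt A -> E -> (pt A -> E) -> E.
Hypothesis hnabla : connection nabla.

(** The connection map has the same expression in every chart. In the chart i, the coordinate field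
    [vec j Q.2] of the preferred chart j is D (trans j i) composed with [trans i j]; its derivative,
    the inhomogeneous term in the change of Gamma, is exactly the second-derivative term of
    [TM_coordE]. *)
Lemma coord_vcomp i Q xi : dom i Q.1 ->
  coord i Q.1 (vcomp nabla Q xi) =
  (@Defs.coord _ _ (TM A) i Q xi).2 +
  gam nabla i (chart i Q.1) (@Defs.coord _ _ (TM A) i Q xi).1 (coord i Q.1 Q.2).
Proof.
move=> iQ; rewrite TM_coordE //=; set j := chart_at Q.1.
have jQ : dom j Q.1 by exact: chart_at_dom.
rewrite /vcomp coordD -addrA; congr (_ + _).
rewrite /christoffel -/j.
rewrite (conn_coord B hA hnabla _ (aopen_dom hA j) jQ (smooth_vf_vec B hA j Q.2) iQ).
congr (_ + _); last by rewrite /j vec_chart_at.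
have jis := trans_smooth hA j i.
have dtd : differentiable ('D_(Q.2) (trans j i)) (trans i j (chart i Q.1)).
  rewrite trans_chart //.
  apply: smooth_on_differentiable (smooth_on_derive _ jis) _.
  exact: img_chart.
have ijd := trans_differentiable hA iQ jQ.
have nn : {near chart i Q.1, 'D_(Q.2) (trans j i) \o trans i j =1 in_chart i (vec j Q.2)}.
  apply: (near_chart (aopen_dom hA j)) => // q iq jq /=.
  rewrite in_chartE // (coord_vec_trans hA _ jq iq) trans_chart // deriveE //.
  exact: trans_differentiable.
rewrite (near_eq_diff nn (differentiable_comp ijd dtd)) diff_comp //= trans_chart //.
by rewrite /Defs.coord -/j diff_trans_comp // diff_trans_id.
Qed.

End TangentBundle.

(** * Differentiability of the inverse matrix, and the standard basis of row vectors *)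

Section MatrixDifferentiable.
Context {R : realType} {P : normedModType R} (x : P).

Lemma differentiable_bigsum (I : finType) (f : I -> P -> R) :
  (forall i, differentiable (f i) x) -> differentiable (fun y => \sum_i f i y) x.
Proof.
by move=> fd; have [] := is_diff_big (fun i => differentiableP (fd i)).
Qed.

Lemma differentiable_bigprod (I : finType) (f : I -> P -> R) :
  (forall i, differentiable (f i) x) -> differentiable (fun y => \prod_i f i y) x.
Proof.
move=> fd; have -> : (fun y => \prod_i f i y) = \prod_i f i.
  by apply/funext => y; rewrite fct_prodE.
elim/big_ind: _ => // f1 f2 h1 h2; exact: differentiableM.
Qed.

Lemma differentiable_det n (M : P -> 'M[R]_n) :
  (forall i j, differentiable (fun y => M y i j) x) ->
  differentiable (fun y => \det (M y)) x.
Proof.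
move=> Md; apply: differentiable_bigsum => s.
apply: differentiableM; first exact: differentiable_cst.
exact: differentiable_bigprod.
Qed.

(** Cramer's rule makes each entry a quotient of polynomials in the entries of M. It is applied to
    the Gram matrix of g to differentiate the gradient. *)
Lemma differentiable_invmx n (M : P -> 'M[R]_n) :
  (\forall y \near x, M y \in unitmx) ->
  (forall i j, differentiable (fun y => M y i j) x) ->
  forall i j, differentiable (fun y => invmx (M y) i j) x.
Proof.
move=> Mu Md i j.
have nn : {near x, (fun y => (\det (M y))^-1 * cofactor (M y) j i) =1
    (fun y => invmx (M y) i j)}.
  by apply: filterS Mu => y My; rewrite /invmx My !mxE.
apply: near_eq_differentiable nn _; apply: differentiableM.
  apply: differentiableV; first exact: differentiable_det.
  by have := nbhs_singleton Mu; rewrite unitmxE unitfE.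
apply: differentiableM; first exact: differentiable_cst.
apply: differentiable_det => k l.
have -> : (fun y => row' j (col' i (M y)) k l) = (fun y => M y (lift j k) (lift i l)).
  by apply/funext => y; rewrite !mxE.
exact: Md.
Qed.

End MatrixDifferentiable.

Section RowBasis.
Context {R : realType} {n : nat}.

Let rco (k : 'I_n) (v : 'rV[R]_n) : R := v 0 k.

Let rco_linear k : linear (rco k).
Proof. by move=> a u v; rewrite /rco !mxE. Qed.

Let rcol (k : 'I_n) : {linear 'rV[R]_n -> R} :=
  HB.pack (rco k) (GRing.isLinear.Build _ _ _ _ _ (rco_linear k)).

Let rco_continuous k : continuous (rcol k).
Proof. exact: coord_continuous. Qed.

Let rcoE v : v = \sum_k rcol k v *: delta_mx 0 k.
Proof. exact: row_sum_delta. Qed.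

Definition rV_basis : lin_basis 'rV[R]_n := LinBasis rco_continuous rcoE.

Lemma differentiable_rV (P : normedModType R) (f : P -> 'rV[R]_n) x :
  (forall k, differentiable (fun y => f y 0 k) x) -> differentiable f x.
Proof.
move=> fd.
have [+ _] := is_diff_big (fun k => is_diffZ_vec (differentiableP (fd k))
   (is_diff_cst (delta_mx 0 k : 'rV[R]_n) x)).
have -> // : (fun y => \sum_k f y 0 k *: (cst (delta_mx 0 k) : P -> 'rV[R]_n) y) = f.
by apply/funext => y; rewrite /cst -row_sum_delta.
Qed.

End RowBasis.

(** * Metric and gradient in charts *)

Section Metric.
Context {R : realType} {E : normedModType R} (B : lin_basis E) {A : atlas E}.
Hypothesis hA : smooth_atlas A.
Variable g : pt A -> E -> E -> R.
Hypothesis hg : riemannian g.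
Implicit Types (i j : idx A) (p q : pt A) (u v w : E).

Local Notation img i W := (chart i @` (dom i `&` W)).

Lemma metric_linearl p a u v w : g p (a *: u + v) w = a * g p u w + g p v w.
Proof. by rewrite !(Defs.metric_sym hg p _ w) (metric_linear hg). Qed.

Lemma metricDl p u v w : g p (u + v) w = g p u w + g p v w.
Proof. by have := metric_linearl p 1 u v w; rewrite scale1r mul1r. Qed.

Lemma metricDr p u v w : g p w (u + v) = g p w u + g p w v.
Proof. by rewrite !(Defs.metric_sym hg p w) metricDl. Qed.

Lemma metric0l p w : g p 0 w = 0.
Proof.
have := metricDl p 0 0 w; rewrite addr0 => /esym.
by move/(congr1 (fun y => y - g p 0 w)); rewrite addrK subrr.
Qed.

Lemma metricZl p a u w : g p (a *: u) w = a * g p u w.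
Proof. by have := metric_linearl p a u 0 w; rewrite addr0 metric0l addr0. Qed.

Lemma metricZr p a u w : g p w (a *: u) = a * g p w u.
Proof. by rewrite !(Defs.metric_sym hg p w) metricZl. Qed.

Lemma metricNl p u w : g p (- u) w = - g p u w.
Proof. by rewrite -scaleN1r metricZl mulN1r. Qed.

Lemma metricNr p u w : g p w (- u) = - g p w u.
Proof. by rewrite !(Defs.metric_sym hg p w) metricNl. Qed.

Lemma metric_nondegenerate p u v : (forall w, g p u w = g p v w) -> u = v.
Proof.
move=> uv; apply/eqP; rewrite -subr_eq0; apply/negPn/negP.
move=> /(metric_pos hg p); rewrite metricDl metricNl uv subrr.
by rewrite ltxx.
Qed.

Definition gm i (x : E) u v : R :=
  g (param i x) (vec i u (param i x)) (vec i v (param i x)).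

Lemma gmE i q u v : dom i q -> gm i (chart i q) u v = g q (vec i u q) (vec i v q).
Proof. by move=> iq; rewrite /gm chartK. Qed.

Lemma metric_chart i q u v : dom i q ->
  g q u v = gm i (chart i q) (coord i q u) (coord i q v).
Proof. by move=> iq; rewrite gmE // !vec_coord. Qed.

Lemma gm_linearl i x a u v w : gm i x (a *: u + v) w = a * gm i x u w + gm i x v w.
Proof. by rewrite /gm vecD vecZ metric_linearl. Qed.

Lemma gm_linearr i x a u v w : gm i x w (a *: u + v) = a * gm i x w u + gm i x w v.
Proof. by rewrite /gm vecD vecZ (metric_linear hg). Qed.

Lemma gm_smooth i u v : smooth_on (img i (dom i)) (gm i ^~ u ^~ v).
Proof.
have := metric_smooth hg (aopen_dom hA i) (smooth_vf_vec B hA i u)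
  (smooth_vf_vec B hA i v).
exact.
Qed.

Variable nabla : pt A -> E -> (pt A -> E) -> E.
Hypothesis hnabla : levi_civita g nabla.

Lemma gm_compatible i p u v w : dom i p ->
  'd (gm i ^~ u ^~ v) (chart i p) w =
  gm i (chart i p) (gam nabla i (chart i p) w u) v +
  gm i (chart i p) u (gam nabla i (chart i p) w v).
Proof.
move=> ip; have hc := lc_connection hnabla.
have := lc_metric hnabla (vec i w p) (aopen_dom hA i) ip
  (smooth_vf_vec B hA i u) (smooth_vf_vec B hA i v).
rewrite (vder_chart hA (i := i)) //; last first.
  exact: smooth_on_differentiable (@gm_smooth i u v) (img_chart ip ip).
rewrite coord_vec // => ->.
by rewrite !gamE // !gmE // !vec_coord.
Qed.

Lemma gam_sym p u v :
  let i := chart_at p in gam nabla i (chart i p) u v = gam nabla i (chart i p) v u.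
Proof.
move=> i; have ip : dom i p := chart_at_dom hA p.
have := lc_torsion_free hnabla (aopen_dom hA i) ip
  (smooth_vf_vec B hA i u) (smooth_vf_vec B hA i v).
rewrite lie_vec // => /subr0_eq h.
by rewrite !gamE // h.
Qed.

End Metric.

Section Gradient.
Context {R : realType} {n : nat} {A : atlas 'rV[R]_n}.
Hypothesis hA : smooth_atlas A.
Variable g : pt A -> 'rV[R]_n -> 'rV[R]_n -> R.
Hypothesis hg : riemannian g.
Variable phi : pt A -> R.
Hypothesis hphi : smooth_fun setT phi.
Implicit Types (i j : idx A) (p q : pt A) (u v w : 'rV[R]_n).

Local Notation img i W := (chart i @` (dom i `&` W)).

Lemma phi_smooth i : smooth_on (img i (dom i)) (phi \o param i).
Proof.
move=> k; apply: Ck_on_sub (hphi i k).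
by move=> _ [p [ip _] <-]; apply: img_chart.
Qed.

Lemma phi_differentiable i p : dom i p ->
  differentiable (phi \o param i) (chart i p).
Proof.
by move=> ip; apply: smooth_on_differentiable (phi_smooth i) (img_chart ip ip).
Qed.

Let gmat i (x : 'rV[R]_n) : 'M[R]_n :=
  \matrix_(k, l) gm g i x (delta_mx 0 k) (delta_mx 0 l).

Let gmat_mul i x u l : (u *m gmat i x) 0 l = gm g i x u (delta_mx 0 l).
Proof.
rewrite mxE {2}(row_sum_delta u).
have g0 w : gm g i x 0 w = 0.
  have := gm_linearl hg i x 1 0 0 w; rewrite scale1r addr0 mul1r => /esym.
  by move/(congr1 (fun y => y - gm g i x 0 w)); rewrite addrK subrr.
under eq_bigr do rewrite mxE.
by elim/big_rec2: _ => [//|k y1 y2 _ ->]; rewrite gm_linearl.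
Qed.

Let gmat_unit i p : dom i p -> gmat i (chart i p) \in unitmx.
Proof.
move=> ip; rewrite -row_free_unit; apply: inj_row_free => u u0.
have gu w : gm g i (chart i p) u w = 0.
  rewrite (row_sum_delta w); have -> : 0 = \sum_(j < n) w 0 j * 0 :> R.
    by rewrite big1 // => k _; rewrite mulr0.
  have g0 : gm g i (chart i p) u 0 = 0.
    have := gm_linearr hg i (chart i p) 1 0 0 u.
    rewrite scale1r addr0 mul1r => /esym.
    by move/(congr1 (fun y => y - gm g i (chart i p) u 0)); rewrite addrK subrr.
  elim/big_rec2: _ => [//|k y1 y2 _ <-]; rewrite gm_linearr //.
  by rewrite -gmat_mul u0 mxE.
have : vec i u p = 0.
  apply: (metric_nondegenerate hg (p := p)) => w.
  rewrite (metric0l hg) -[w](vec_coord hA w ip) -gmE //; exact: gu.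
by move/(congr1 (coord i p)); rewrite coord_vec // /Defs.coord linear0.
Qed.

(** The classical coordinate formula for the gradient: the row of partial derivatives times the
    inverse Gram matrix. Since [grad] is a mere choice by [xget], this formula supplies both its
    existence and its regularity. *)
Let grd i (x : 'rV[R]_n) : 'rV[R]_n :=
  (\row_l 'd (phi \o param i) x (delta_mx 0 l)) *m invmx (gmat i x).

Let gm_grd i p v : dom i p ->
  gm g i (chart i p) (grd i (chart i p)) v = 'd (phi \o param i) (chart i p) v.
Proof.
move=> ip; rewrite {2}(row_sum_delta v) linear_sum /= {1}(row_sum_delta v).
have g0 u : gm g i (chart i p) u 0 = 0.
  have := gm_linearr hg i (chart i p) 1 0 0 u.
  rewrite scale1r addr0 mul1r => /esym.
  by move/(congr1 (fun y => y - gm g i (chart i p) u 0)); rewrite addrK subrr.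
elim/big_rec2: _ => [//|k y1 y2 _ <-]; rewrite gm_linearr // linearZ /=.
by rewrite -gmat_mul mulmxKV ?gmat_unit // mxE.
Qed.

(** The default value 0 of [xget] is ruled out by a witness: the vector whose components in the
    preferred chart are given by [grd]. *)
Lemma gradP p v : g p (grad g phi p) v = vder p v phi.
Proof.
pose i := chart_at p; have ip : dom i p := chart_at_dom hA p.
suff : [set w | forall v, g p w v = vder p v phi] (vec i (grd i (chart i p)) p).
  by move=> h; exact: (xgetI 0 h).
move=> w; rewrite -{1}(vec_coord hA w ip) -gmE // gm_grd //.
by rewrite (vder_chart hA _ ip (phi_differentiable ip)).
Qed.

Lemma gm_grad i p v : dom i p ->
  gm g i (chart i p) (in_chart i (grad g phi) (chart i p)) v =
  'd (phi \o param i) (chart i p) v.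
Proof.
move=> ip; rewrite in_chartE // gmE // vec_coord // gradP.
by rewrite (vder_chart hA _ ip (phi_differentiable ip)) coord_vec.
Qed.

(** By nondegeneracy of g, [grad] coincides with [grd] on the whole chart domain, and [grd] is built
    from derivatives of phi and an inverse matrix. *)
Lemma grad_differentiable i p : dom i p ->
  differentiable (in_chart i (grad g phi)) (chart i p).
Proof.
move=> ip.
have nn : {near chart i p, grd i =1 in_chart i (grad g phi)}.
  apply: (near_chart (aopen_dom hA i)) => // q iq _.
  rewrite -[LHS](coord_vec hA _ iq) in_chartE //; congr (coord _ _ _).
  apply: (metric_nondegenerate hg (p := q)) => w.
  rewrite gradP -{1}(vec_coord hA w iq) -gmE // gm_grd //.
  by rewrite (vder_chart hA _ iq (phi_differentiable iq)).
apply: near_eq_differentiable nn _; apply: differentiable_rV => k.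
have -> : (fun y => grd i y 0 k) = (fun y => \sum_l
    'd (phi \o param i) y (delta_mx 0 l) * invmx (gmat i y) l k).
  by apply/funext => y; rewrite mxE; apply: eq_bigr => l _; rewrite !mxE.
apply: differentiable_bigsum => l; apply: differentiableM.
  have [] // := is_diff_diff rV_basis (img_open i (aopen_dom hA i)) (img_chart ip ip)
    (phi_smooth i) (is_diff_id _) (is_diff_cst (delta_mx 0 l) (chart i p)).
apply: differentiable_invmx => [|r s].
  near=> y.
  have [iy _ <-] : [/\ dom i (param i y), dom i (param i y) & chart i (param i y) = y].
    apply: (imgP hA); near: y; apply: open_nbhs_nbhs; split.
      exact/img_open/aopen_dom.
    exact: img_chart.
  exact: gmat_unit.
have -> : (fun y => gmat i y r s) = gm g i ^~ (delta_mx 0 r) ^~ (delta_mx 0 s).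
  by apply/funext => y; rewrite mxE.
apply: smooth_on_differentiable (img_chart ip ip).
exact: (gm_smooth rV_basis hA hg).
Unshelve. all: by end_near. Qed.

End Gradient.

(** * The pullback connection *)

Section Pullback.
Context {R : realType} {E : normedModType R} (B : lin_basis E) {A : atlas E}.
Hypothesis hA : smooth_atlas A.
Variable nabla : pt A -> E -> (pt A -> E) -> E.
Hypothesis hnabla : connection nabla.
Implicit Types (i j : idx A) (p q : pt A) (P Q : pt (TM A)) (xi : E * E).
Implicit Types (s : pt (TM A) -> E) (W : set (pt (TM A))).

Local Notation chartTM := (@chart _ _ (TM A)).
Local Notation paramTM := (@param _ _ (TM A)).
Local Notation coordTM := (@Defs.coord _ _ (TM A)).
Local Notation in_chartTM := (@in_chart _ _ (TM A)).
Local Notation imgTM i W := (chartTM i @` ([set Q | dom i Q.1] `&` W)).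

(* A section of pi^*TM and the connection pi^*nabla, read in the chart i. *)
Definition sec i s (z : E * E) : E := coord i (param i z.1) (s (paramTM i z)).

Definition chart_cov i (z xi : E * E) (f : E * E -> E) : E :=
  'd f z xi + gam nabla i z.1 xi.1 (f z).

Definition smooth_sec W s := forall i, smooth_on (imgTM i W) (sec i s).

Lemma paramK i Q : dom i Q.1 -> paramTM i (chartTM i Q) = Q.
Proof. by move=> iQ; rewrite (chartK (TM_smooth_atlas B hA)). Qed.

Lemma imgTM_open i W : @aopen _ _ (TM A) W -> open (imgTM i W).
Proof. exact: (@img_open _ _ (TM A) i W). Qed.

Lemma secE i s Q : dom i Q.1 -> sec i s (chartTM i Q) = coord i Q.1 (s Q).
Proof. by move=> iQ; rewrite /sec paramK //= chartK. Qed.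

Lemma sec_dpi i (Y : pt (TM A) -> E * E) Q : dom i Q.1 ->
  sec i (fun Q => dpi Q (Y Q)) (chartTM i Q) = (in_chartTM i Y (chartTM i Q)).1.
Proof.
move=> iQ; rewrite secE // (in_chartE (TM_smooth_atlas B hA)) //.
by rewrite (TM_coordE B hA _ iQ).
Qed.

Lemma sec_vcomp i (Y : pt (TM A) -> E * E) Q : dom i Q.1 ->
  let z := chartTM i Q in
  sec i (fun Q => vcomp nabla Q (Y Q)) z =
  (in_chartTM i Y z).2 + gam nabla i z.1 (in_chartTM i Y z).1 z.2.
Proof.
move=> iQ /=; rewrite secE // (in_chartE (TM_smooth_atlas B hA)) //.
by rewrite (coord_vcomp B hA hnabla _ iQ).
Qed.

Lemma smooth_sec_dpi W (Y : pt (TM A) -> E * E) : @aopen _ _ (TM A) W ->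
  smooth_vf W Y -> smooth_sec W (fun Q => dpi Q (Y Q)).
Proof.
move=> Wo WY i k; have io := @imgTM_open i W Wo.
apply: (Ck_on_eq io _ (Ck_on_lin io (@fst_continuous R E E) (WY i k))).
by move=> _ [Q [iQ _] <-]; rewrite sec_dpi.
Qed.

(** By [sec_vcomp] the section is y.2 + Gamma(y.1, u), where u is the fibre coordinate: a bilinear
    expression in smooth arguments whose coefficients depend smoothly on the base point. *)
Lemma smooth_sec_vcomp W (Y : pt (TM A) -> E * E) : @aopen _ _ (TM A) W ->
  smooth_vf W Y -> smooth_sec W (fun Q => vcomp nabla Q (Y Q)).
Proof.
move=> Wo WY i k; have io := @imgTM_open i W Wo.
have Y1 := Ck_on_lin io (@fst_continuous R E E) (WY i k).
have Y2 := Ck_on_lin io (@snd_continuous R E E) (WY i k).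
have h1 := Ck_on_linear k io (@fst_continuous R E E).
have h2 := Ck_on_linear k io (@snd_continuous R E E).
have gl x : (chart i @` (dom i `&` dom i)) x -> forall c u v w,
    gam nabla i x (c *: u + v) w = c *: gam nabla i x u w + gam nabla i x v w.
  by move=> [q [iq _] <-] c u v w; apply: (gam_linearl B hA hnabla).
have gr x : (chart i @` (dom i `&` dom i)) x -> forall c u v w,
    gam nabla i x w (c *: u + v) = c *: gam nabla i x w u + gam nabla i x w v.
  by move=> [q [iq _] <-] c u v w; apply: (gam_linearr B hA hnabla).
have hU z : imgTM i W z -> (chart i @` (dom i `&` dom i)) z.1.
  by move=> [Q [iQ _] <-]; exact: img_chart.
have gs u v := gam_smooth B hA hnabla i u v k.
have Y3 := Ck_on_bilinear_param B gl gr B io hU gs h1 Y1 h2.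
apply: (Ck_on_eq io _ (Ck_onD io Y2 Y3)).
by move=> _ [Q [iQ _] <-]; rewrite sec_vcomp.
Qed.

Lemma sec_differentiable i W s Q : smooth_sec W s -> W Q -> dom i Q.1 ->
  differentiable (sec i s) (chartTM i Q).
Proof.
move=> Ws WQ iQ; apply: smooth_on_differentiable (Ws i) _.
exact: (@img_chart _ _ (TM A) i W Q).
Qed.

Lemma pullback_connE Q xi s :
  let i := chart_at Q.1 in
  pullback_conn nabla Q xi s = chart_cov i (chartTM i Q) xi (sec i s).
Proof.
move=> i; have iQ : dom i Q.1 := chart_at_dom hA Q.1.
rewrite /chart_cov secE // coord_chart_at //= gam_chart_at //.
Qed.

(* [pullback_conn nabla Q xi s] is the vertical part of the image of xi under
   the tangent map of Q |-> (pi Q, s Q), a map from TM to TM, so its law of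
   change of charts is the one of [vcomp]. *)
Lemma coord_pullback i W Q xi s : @aopen _ _ (TM A) W -> W Q ->
  smooth_sec W s -> dom i Q.1 ->
  coord i Q.1 (pullback_conn nabla Q xi s) =
  chart_cov i (chartTM i Q) (coordTM i Q xi) (sec i s).
Proof.
move=> Wo WQ Ws iQ; have hT := TM_smooth_atlas B hA.
pose j := chart_at Q.1; have jQ : dom j Q.1 := chart_at_dom hA Q.1.
pose sig k (z : E * E) := (z.1, sec k s z).
have sigE k Q' : dom k Q'.1 -> sig k (chartTM k Q') = chartTM k (Q'.1, s Q').
  by move=> kQ; rewrite /sig secE.
have sig_diff k : dom k Q.1 -> is_diff (chartTM k Q) (sig k)
    (fun z => (z.1, 'd (sec k s) (chartTM k Q) z)).
  move=> kQ; exact: (is_diff_pair (is_diff_fst _)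
    (differentiableP (sec_differentiable Ws WQ kQ))).
pose S : pt (TM A) := (Q.1, s Q).
have tQ := @trans_differentiable _ _ (TM A) hT j i Q jQ iQ.
have tS := @trans_differentiable _ _ (TM A) hT j i S jQ iQ.
have tQe : @trans _ _ (TM A) j i (chartTM j Q) = chartTM i Q.
  exact: (@trans_chart _ _ (TM A) hT j i Q jQ).
(* The map Q |-> (pi Q, s Q) is read as [sig j] in one chart and as [sig i] in the other.
   Differentiating this compatibility at Q yields [etaE], the change of charts for the image [eta]
   of xi. *)
have nn : {near chartTM j Q, @trans _ _ (TM A) j i \o sig j =1
     sig i \o @trans _ _ (TM A) j i}.
  have WWo := aopenI hT Wo (@aopen_dom _ _ (TM A) hT i).
  apply: (near_chart (A := TM A) WWo) => // Q' jQ' [_ iQ'].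
  change (@trans _ _ (TM A) j i (sig j (chartTM j Q')) =
    sig i (@trans _ _ (TM A) j i (chartTM j Q'))).
  rewrite sigE // (@trans_chart _ _ (TM A) hT j i Q' jQ') sigE //.
  exact: (@trans_chart _ _ (TM A) hT j i (Q'.1, s Q') jQ').
have [sjd sjE] := sig_diff j jQ; have [sid siE] := sig_diff i iQ.
have dL : is_diff (chartTM j Q) (@trans _ _ (TM A) j i \o sig j)
    ('d (@trans _ _ (TM A) j i) (chartTM j S) \o
     (fun z => (z.1, 'd (sec j s) (chartTM j Q) z))).
  apply: is_diff_comp; first exact: sig_diff.
  rewrite sigE //; exact: differentiableP.
have dR : is_diff (chartTM j Q) (sig i \o @trans _ _ (TM A) j i)
    ((fun z => (z.1, 'd (sec i s) (chartTM i Q) z)) \o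
     'd (@trans _ _ (TM A) j i) (chartTM j Q)).
  apply: is_diff_comp; first exact: differentiableP.
  rewrite tQe; exact: sig_diff.
pose eta : E * E := (xi.1, 'd (sec j s) (chartTM j Q) xi).
have etaE : coordTM i S eta =
    ((coordTM i Q xi).1, 'd (sec i s) (chartTM i Q) (coordTM i Q xi)).
  have [_ d1] := near_eq_is_diff nn dL; have [_ d2] := dR.
  by have := congr1 (fun l => l xi) (etrans (esym d1) d2).
have -> : pullback_conn nabla Q xi s = vcomp nabla S eta by [].
rewrite (coord_vcomp B hA hnabla (Q := S) eta iQ) etaE /=.
by rewrite /chart_cov secE.
Qed.

End Pullback.

(** The bookkeeping of [cd_flat]: s is the second derivative of f, a and e contain the derivative of
    a field, c that of Gamma, v is Gamma(Y, df X), and h is the double Gamma term. The four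
    hypotheses are Schwarz, linearity of Gamma twice, and [gam_flat]. *)
Lemma flat_cancel (R : realType) (E : normedModType R) (B : lin_basis E)
    (s s' a a' c c' e e' v v' g g' h h' : E) :
  s = s' -> g = v' + h -> g' = v + h' -> c + h = c' + h' ->
  s + a + (c + e + v) + g - (s' + a' + (c' + e' + v') + g') =
  a + e - (a' + e').
Proof.
move=> <- -> -> /(congr1 (fun t => t - h)); rewrite addrK => ->.
by apply: (bco_inj (B := B)) => k; rewrite !(linearD, linearN) /=; ring.
Qed.

(** * Covariant derivatives of sections in one chart, and their commutation *)

Section CovariantDerivative.
Context {R : realType} {E : normedModType R} (B : lin_basis E) {A : atlas E}.
Hypothesis hA : smooth_atlas A.
Variable nabla : pt A -> E -> (pt A -> E) -> E.
Hypothesis hnabla : connection nabla.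
Implicit Types (i j : idx A) (p q : pt A) (P Q : pt (TM A)) (xi eta : E * E).

Local Notation chartTM := (@chart _ _ (TM A)).
Local Notation img i W := (chart i @` (dom i `&` W)).
Local Notation cd := (chart_cov nabla).

Lemma cd_linear i Q f c xi eta : dom i Q.1 ->
  cd i (chartTM i Q) (c *: xi + eta) f =
  c *: cd i (chartTM i Q) xi f + cd i (chartTM i Q) eta f.
Proof.
move=> iQ; rewrite /chart_cov linearP /= (gam_linearl B hA hnabla) //.
by rewrite scalerDr addrACA.
Qed.

Lemma cdB i Q f xi eta : dom i Q.1 ->
  cd i (chartTM i Q) (xi - eta) f =
  cd i (chartTM i Q) xi f - cd i (chartTM i Q) eta f.
Proof.
move=> iQ; rewrite [xi - eta]addrC -scaleN1r cd_linear // scaleN1r.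
by rewrite addrC.
Qed.

Lemma cdD i Q (f f' : E * E -> E) xi : dom i Q.1 ->
  differentiable f (chartTM i Q) -> differentiable f' (chartTM i Q) ->
  cd i (chartTM i Q) xi (fun y => f y + f' y) =
  cd i (chartTM i Q) xi f + cd i (chartTM i Q) xi f'.
Proof.
move=> iQ fd fd'.
have [_ e] := is_diffD (differentiableP fd) (differentiableP fd').
apply: (etrans (congr1 (fun l => l xi + gam nabla i (chart i Q.1) xi.1
  (f (chartTM i Q) + f' (chartTM i Q))) e)).
have gD u v w : gam nabla i (chart i Q.1) w (u + v) =
    gam nabla i (chart i Q.1) w u + gam nabla i (chart i Q.1) w v.
  by have := gam_linearr B hA hnabla 1 u v w iQ; rewrite !scale1r.
by rewrite gD addrACA.
Qed.

Lemma cdZ i Q (c : E * E -> R) (f : E * E -> E) xi : dom i Q.1 ->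
  differentiable c (chartTM i Q) -> differentiable f (chartTM i Q) ->
  cd i (chartTM i Q) xi (fun y => c y *: f y) =
  'd c (chartTM i Q) xi *: f (chartTM i Q) +
  c (chartTM i Q) *: cd i (chartTM i Q) xi f.
Proof.
move=> iQ dc fd.
have [_ e] := is_diffZ_vec (differentiableP dc) (differentiableP fd).
apply: (etrans (congr1 (fun l => l xi + gam nabla i (chart i Q.1) xi.1
  (c (chartTM i Q) *: f (chartTM i Q))) e)).
have g0 u : gam nabla i (chart i Q.1) u 0 = 0.
  have := gam_linearr B hA hnabla 1 0 0 u iQ; rewrite !scale1r addr0 => /esym.
  by move/(congr1 (fun y => y - gam nabla i (chart i Q.1) u 0));
    rewrite addrK subrr.
have gZ a u v : gam nabla i (chart i Q.1) u (a *: v) =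
    a *: gam nabla i (chart i Q.1) u v.
  by have := gam_linearr B hA hnabla a v 0 u iQ; rewrite !addr0 g0 addr0.
by rewrite gZ -addrA -scalerDr.
Qed.

Lemma cd_near i z xi (f f' : E * E -> E) :
  {near z, f =1 f'} -> differentiable f z -> cd i z xi f' = cd i z xi f.
Proof.
move=> ff fd.
apply: (etrans (congr1 (fun l => l xi + gam nabla i z.1 xi.1 (f' z))
  (near_eq_diff ff fd))).
by rewrite -(nbhs_singleton ff).
Qed.

Lemma is_diff_gam i Q (a b : E * E -> E) da db : dom i Q.1 ->
  let z := chartTM i Q in is_diff z a da -> is_diff z b db ->
  is_diff z (fun y => gam nabla i y.1 (a y) (b y))
    (fun xi => 'd (gam nabla i ^~ (a z) ^~ (b z)) (z.1) xi.1
       + gam nabla i z.1 (da xi) (b z) + gam nabla i z.1 (a z) (db xi)).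
Proof.
move=> iQ z ad bd.
have zU : img i (dom i) z.1 := img_chart iQ iQ.
apply: (is_diff_bilinear_param B (img_open i (aopen_dom hA i)) _ _ zU _
  (is_diff_fst z) ad bd).
- by move=> _ [q [iq _] <-] c u v w; apply: (gam_linearl B hA hnabla).
- by move=> _ [q [iq _] <-] c u v w; apply: (gam_linearr B hA hnabla).
- move=> u v; apply: smooth_on_differentiable zU.
  exact: (gam_smooth B hA hnabla).
Qed.

Lemma is_diff_cd i Q (V : set (E * E)) (f : E * E -> E) (Y : E * E -> E * E) dY :
  dom i Q.1 -> let z := chartTM i Q in
  open V -> V z -> smooth_on V f -> is_diff z Y dY ->
  is_diff z (fun y => cd i y (Y y) f)
    (fun xi => ('d ('D_(Y z) f) z xi + 'd f z (dY xi))
       + ('d (gam nabla i ^~ (Y z).1 ^~ (f z)) (z.1) xi.1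
          + gam nabla i z.1 (dY xi).1 (f z)
          + gam nabla i z.1 (Y z).1 ('d f z xi))).
Proof.
move=> iQ z Vo Vz Vf Yd.
have fd := differentiableP (smooth_on_differentiable Vf Vz).
have Y1d := is_diff_comp Yd (is_diff_fst (Y z)).
have d1 := is_diff_diff (pair_basis B B) Vo Vz Vf (is_diff_id z) Yd.
have d2 := is_diff_gam iQ Y1d fd.
exact: (is_diffD d1 d2).
Qed.

Section Flat.
Hypothesis hflat : flat nabla.

(** Second derivatives of f cancel by Schwarz, and derivatives of Gamma together with the double
    Gamma terms cancel by [gam_flat]. What survives differentiates the fields X and Y, that is, the
    derivative along their bracket. *)
Lemma cd_flat P (V : set (E * E)) (f : E * E -> E) (X Y : E * E -> E * E) :
  let i := chart_at P.1 in let z := chartTM i P in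
  open V -> V z -> smooth_on V f -> differentiable X z -> differentiable Y z ->
  cd i z (X z) (fun y => cd i y (Y y) f) - cd i z (Y z) (fun y => cd i y (X y) f)
  = cd i z ('d Y z (X z) - 'd X z (Y z)) f.
Proof.
move=> i z Vo Vz Vf Xd Yd; have iP : dom i P.1 := chart_at_dom hA P.1.
have [_ eY] := is_diff_cd iP Vo Vz Vf (differentiableP Yd).
have [_ eX] := is_diff_cd iP Vo Vz Vf (differentiableP Xd).
have LX : cd i z (X z) (fun y => cd i y (Y y) f) = _ :=
  congr1 (fun l => l (X z) + gam nabla i z.1 (X z).1 (cd i z (Y z) f)) eY.
have LY : cd i z (Y z) (fun y => cd i y (X y) f) = _ :=
  congr1 (fun l => l (Y z) + gam nabla i z.1 (Y z).1 (cd i z (X z) f)) eX.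
rewrite cdB // LX LY {LX LY eX eY}.
have fd v : differentiable ('D_v f) z.
  exact: smooth_on_differentiable (smooth_on_derive v Vf) Vz.
have sw : 'd ('D_(Y z) f) z (X z) = 'd ('D_(X z) f) z (Y z).
  exact: (etrans (esym (deriveE _ (fd _)))
    (etrans (Schwarz B _ _ Vo Vz Vf) (deriveE _ (fd _)))).
have gD u v w : gam nabla i z.1 w (u + v) =
    gam nabla i z.1 w u + gam nabla i z.1 w v.
  by have := gam_linearr B hA hnabla 1 u v w iP; rewrite !scale1r.
have fl := gam_flat B hA hnabla hflat P.1 (X z).1 (Y z).1 (f z).
have hX := gD ('d f z (Y z)) (gam nabla i z.1 (Y z).1 (f z)) (X z).1.
have hY := gD ('d f z (X z)) (gam nabla i z.1 (X z).1 (f z)) (Y z).1.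
rewrite /chart_cov.
exact: (flat_cancel B _ _ _ _ sw hX hY fl).
Qed.
End Flat.
End CovariantDerivative.

(** * The connection and curvature of the weighted metric *)

Section Splitting.
Context {R : realType} {E : normedModType R} (B : lin_basis E) {A : atlas E}.
Hypothesis hA : smooth_atlas A.
Variable nabla : pt A -> E -> (pt A -> E) -> E.
Hypothesis hnabla : connection nabla.
Implicit Types (P Q : pt (TM A)) (xi eta : E * E) (a b : E).

Lemma christoffel_linear P c a b :
  christoffel nabla P (c *: a + b) = c *: christoffel nabla P a + christoffel nabla P b.
Proof.
have iP := chart_at_dom hA P.1.
exact: (conn_linear hnabla _ _ _ (aopen_dom hA _) iP (smooth_vf_vec B hA _ _)).
Qed.

Lemma christoffel0 P : christoffel nabla P 0 = 0.
Proof.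
have := christoffel_linear P 1 0 0; rewrite !scale1r addr0 => /esym.
by move/(congr1 (fun y => y - christoffel nabla P 0)); rewrite addrK subrr.
Qed.

Lemma vcomp_linear P c xi eta :
  vcomp nabla P (c *: xi + eta) = c *: vcomp nabla P xi + vcomp nabla P eta.
Proof. by rewrite /vcomp /= christoffel_linear scalerDr addrACA. Qed.

Lemma vcompD P xi eta : vcomp nabla P (xi + eta) = vcomp nabla P xi + vcomp nabla P eta.
Proof. by have := vcomp_linear P 1 xi eta; rewrite !scale1r. Qed.

Lemma vcomp0 P : vcomp nabla P 0 = 0.
Proof. by rewrite /vcomp /= christoffel0 addr0. Qed.

Lemma vcompZ P c xi : vcomp nabla P (c *: xi) = c *: vcomp nabla P xi.
Proof. by have := vcomp_linear P c xi 0; rewrite !addr0 vcomp0 addr0. Qed.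

Lemma vcompN P xi : vcomp nabla P (- xi) = - vcomp nabla P xi.
Proof. by rewrite -scaleN1r vcompZ scaleN1r. Qed.

Lemma vcomp_hlift P a : vcomp nabla P (hlift nabla P a) = 0.
Proof. by rewrite /vcomp /hlift /= addNr. Qed.

Lemma vcomp_vlift P b : vcomp nabla P (vlift P b) = b.
Proof. by rewrite /vcomp /vlift /= christoffel0 addr0. Qed.

Lemma vcomp_vpart P xi : vcomp nabla P (vpart nabla P xi) = vcomp nabla P xi.
Proof. by rewrite /vpart vcomp_vlift. Qed.

Lemma tangent_ext P xi eta : dpi P xi = dpi P eta ->
  vcomp nabla P xi = vcomp nabla P eta -> xi = eta.
Proof.
case: xi eta => [a b] [a' b']; rewrite /vcomp /dpi /= => <-.
by move/addIr => <-.
Qed.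

End Splitting.

Section Warped.
Context {R : realType} {n : nat} {A : atlas 'rV[R]_n}.
Local Notation E := 'rV[R]_n.
Local Notation B := (@rV_basis R n).
Variables (g : pt A -> E -> E -> R) (nabla : pt A -> E -> (pt A -> E) -> E).
Variables (f1 : R) (phi : pt A -> R).
Hypotheses (hA : smooth_atlas A) (hg : riemannian g).
Hypotheses (hnabla : levi_civita g nabla) (hflat : flat nabla).
Hypotheses (hf1 : 0 < f1) (hphi : smooth_fun setT phi).
Implicit Types (i j : idx A) (p q : pt A) (P Q : pt (TM A)) (xi eta : E * E).
Implicit Types (W : set (pt (TM A))) (X Y Z : pt (TM A) -> E * E).

Local Notation chartTM := (@chart _ _ (TM A)).
Local Notation paramTM := (@param _ _ (TM A)).
Local Notation coordTM := (@Defs.coord _ _ (TM A)).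
Local Notation in_chartTM := (@in_chart _ _ (TM A)).
Local Notation img i W := (chart i @` (dom i `&` W)).
Local Notation cd := (chart_cov nabla).
Local Notation f2 := (fun p => expR (2 * phi p)).
Local Notation hN := (lc_connection hnabla).
Local Notation G := (weighted_metric g nabla (fun=> f1) f2).
Local Notation Ypi Y := (fun Q => dpi Q (Y Q)).
Local Notation Yv Y := (fun Q => vcomp nabla Q (Y Q)).

(** Compatibility of nabla with g turns the derivative of the metric coefficients into two Gamma
    terms, which complete the ordinary derivatives of a and b to covariant ones. *)
Lemma is_diff_gm i Q (a b : E * E -> E) : dom i Q.1 ->
  let z := chartTM i Q in differentiable a z -> differentiable b z ->
  is_diff z (fun y => gm g i y.1 (a y) (b y))
    (fun xi => gm g i z.1 (cd i z xi a) (b z) + gm g i z.1 (a z) (cd i z xi b)).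
Proof.
move=> iQ z ad bd.
have zU : img i (dom i) z.1 := img_chart iQ iQ.
have gmd u v : differentiable (gm g i ^~ u ^~ v) z.1.
  exact: smooth_on_differentiable (gm_smooth B hA hg i u v) zU.
have [d dE] := is_diff_bilinear_param B (img_open i (aopen_dom hA i))
  (fun x _ c u v w => gm_linearl hg i x c u v w)
  (fun x _ c u v w => gm_linearr hg i x c u v w) zU gmd (is_diff_fst z)
  (differentiableP ad) (differentiableP bd).
split; first exact: d.
apply: (etrans dE); apply/funext => xi.
rewrite (gm_compatible B hA hg hnabla) //.
have gl u v w : gm g i z.1 (u + v) w = gm g i z.1 u w + gm g i z.1 v w.
  by have := gm_linearl hg i z.1 1 u v w; rewrite scale1r mul1r.
have gr u v w : gm g i z.1 w (u + v) = gm g i z.1 w u + gm g i z.1 w v.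
  by have := gm_linearr hg i z.1 1 u v w; rewrite scale1r mul1r.
by rewrite /chart_cov gl gr; ring.
Qed.

Lemma gm_chart_at p u v :
  let i := chart_at p in gm g i (chart i p) u v = g p u v.
Proof. by move=> i; rewrite gmE ?vec_chart_at //; apply: chart_at_dom. Qed.

(** The right-hand side of the connection formula. Its direction is a single vector rather than a
    field, so that it can also be evaluated along a bracket. *)
Definition warped P xi Y : E * E :=
  conn_HV nabla P xi Y + vder P.1 (dpi P xi) phi *: vpart nabla P (Y P)
  + vder P.1 (dpi P (Y P)) phi *: vpart nabla P xi
  - (f2 P.1 / f1 * sasaki g nabla P (vpart nabla P xi) (vpart nabla P (Y P)))
    *: hlift nabla P (grad g phi P.1).

Lemma sasaki_vpart P xi eta : sasaki g nabla P (vpart nabla P xi) eta =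
  g P.1 (vcomp nabla P xi) (vcomp nabla P eta).
Proof.
rewrite /sasaki /weighted_metric (vcomp_vpart B hA hN) /dpi /=.
by rewrite (metric0l hg) !mul1r add0r.
Qed.

Lemma dpi_warped P xi Y : dpi P (warped P xi Y) =
  pullback_conn nabla P xi (Ypi Y)
  - (f2 P.1 / f1 * g P.1 (vcomp nabla P xi) (vcomp nabla P (Y P)))
    *: grad g phi P.1.
Proof.
rewrite /warped sasaki_vpart (vcomp_vpart B hA hN) /dpi /=.
by rewrite !scaler0 !addr0.
Qed.

Lemma vcomp_warped P xi Y : vcomp nabla P (warped P xi Y) =
  pullback_conn nabla P xi (Yv Y) + vder P.1 (dpi P xi) phi *: vcomp nabla P (Y P)
  + vder P.1 (dpi P (Y P)) phi *: vcomp nabla P xi.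
Proof.
rewrite /warped /conn_HV !(vcompD B hA hN) (vcompN B hA hN) !(vcompZ B hA hN).
rewrite !vcomp_hlift !(vcomp_vpart B hA hN) (vcomp_vlift B hA hN).
by rewrite add0r scaler0 subr0.
Qed.

Local Notation hT := (TM_smooth_atlas B hA).

Lemma in_chartTM_differentiable i W Y Q : smooth_vf W Y -> W Q -> dom i Q.1 ->
  differentiable (in_chartTM i Y) (chartTM i Q).
Proof. exact: (@in_chart_differentiable _ _ (TM A) i W Y Q). Qed.

Lemma cd_sec_dpi i W Y Q xi : @aopen _ _ (TM A) W -> W Q -> smooth_vf W Y ->
  dom i Q.1 -> let z := chartTM i Q in
  cd i z xi (sec i (Ypi Y)) =
  ('d (in_chartTM i Y) z xi).1 + gam nabla i z.1 xi.1 (in_chartTM i Y z).1.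
Proof.
move=> Wo WQ WY iQ z.
have Yd := differentiableP (in_chartTM_differentiable WY WQ iQ).
have nn : {near z, fst \o in_chartTM i Y =1 sec i (Ypi Y)}.
  apply: (near_chart (A := TM A) (i := i) Wo) => // Q' iQ' _.
  by rewrite (sec_dpi B hA).
have [_ e] := near_eq_is_diff nn (is_diff_comp Yd (is_diff_fst _)).
apply: (etrans (congr1 (fun l => l xi + gam nabla i z.1 xi.1 (sec i (Ypi Y) z)) e)).
by rewrite (sec_dpi B hA).
Qed.

(** The expression y.2 + Gamma(y.1, z.2) is differentiated. The fibre coordinate z.2 varies too,
    which accounts for the term Gamma(y.1, xi.2). *)
Lemma cd_sec_vcomp i W Y Q xi : @aopen _ _ (TM A) W -> W Q -> smooth_vf W Y ->
  dom i Q.1 -> let z := chartTM i Q in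
  let y := in_chartTM i Y z in let dy := 'd (in_chartTM i Y) z xi in
  cd i z xi (sec i (Yv Y)) =
  dy.2 + ('d (gam nabla i ^~ y.1 ^~ z.2) (z.1) xi.1 + gam nabla i z.1 dy.1 z.2
          + gam nabla i z.1 y.1 xi.2)
  + gam nabla i z.1 xi.1 (y.2 + gam nabla i z.1 y.1 z.2).
Proof.
move=> Wo WQ WY iQ z y dy.
have Yd := differentiableP (in_chartTM_differentiable WY WQ iQ).
have d1 := is_diff_comp Yd (is_diff_fst _).
have d2 := is_diff_comp Yd (is_diff_snd _).
have d3 := is_diff_gam B hA hN iQ d1 (is_diff_snd z).
have nn : {near z, (fun x => (in_chartTM i Y x).2 +
    gam nabla i x.1 (in_chartTM i Y x).1 x.2) =1 sec i (Yv Y)}.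
  apply: (near_chart (A := TM A) (i := i) Wo) => // Q' iQ' _.
  by rewrite (sec_vcomp B hA hN).
have [_ e] := near_eq_is_diff nn (is_diffD d2 d3).
apply: (etrans (congr1 (fun l => l xi + gam nabla i z.1 xi.1 (sec i (Yv Y) z)) e)).
by rewrite (sec_vcomp B hA hN).
Qed.

(** The hypothesis is [gam_flat] at the fibre vector u: c stands for the derivative of Gamma(Y, u)
    along X with Y frozen, h for Gamma(X, Gamma(Y, u)). The terms named u and u' are the mixed ones
    that pair off. *)
Lemma torsion_cancel (a a' c c' e e' u u' h h' : E) : c + h = c' + h' ->
  a + (c + e + u) + (u' + h) - (a' + (c' + e' + u') + (u + h')) =
  a - a' + (e - e').
Proof.
move=> /(congr1 (fun t => t - h)); rewrite addrK => ->.
by apply/rowP => k; rewrite !mxE; ring.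
Qed.

Lemma gamTM_D i Q u v w : dom i Q.1 ->
  gam nabla i (chart i Q.1) w (u + v) =
    gam nabla i (chart i Q.1) w u + gam nabla i (chart i Q.1) w v.
Proof. by move=> iQ; have := gam_linearr B hA hN 1 u v w iQ; rewrite !scale1r. Qed.

Lemma in_chartTM_at Y P : in_chartTM (chart_at P.1) Y (chartTM (chart_at P.1) P) = Y P.
Proof.
rewrite (in_chartE hT); last exact: (chart_at_dom hA P.1).
exact: (coord_chart_at hT).
Qed.

(** Horizontally, Gamma and the delta term are symmetric in X and Y. Vertically, the terms in phi
    are symmetric, and what remains besides the bracket is R(X, Y) applied to the fibre vector
    [P.2], which vanishes by flatness. *)
Lemma warped_torsion W X Y P : @aopen _ _ (TM A) W -> W P ->
  smooth_vf W X -> smooth_vf W Y ->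
  warped P (X P) Y - warped P (Y P) X = @lie _ _ (TM A) X Y P.
Proof.
move=> Wo WP WX WY.
pose i := chart_at P.1; have iP : dom i P.1 := chart_at_dom hA P.1.
pose z := chartTM i P.
have zE : z.2 = P.2 by exact: coord_chart_at.
have lieE : @lie _ _ (TM A) X Y P =
  'd (in_chartTM i Y) z (X P) - 'd (in_chartTM i X) z (Y P) by [].
have XE : in_chartTM i X z = X P := in_chartTM_at X P.
have YE : in_chartTM i Y z = Y P := in_chartTM_at Y P.
have sg := gam_sym B hA hnabla P.1 (X P).1 (Y P).1.
have fl := gam_flat B hA hN hflat P.1 (X P).1 (Y P).1 P.2.
apply: (tangent_ext (nabla := nabla) (P := P)).
  have -> : dpi P (warped P (X P) Y - warped P (Y P) X) =
    dpi P (warped P (X P) Y) - dpi P (warped P (Y P) X) by [].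
  rewrite !dpi_warped !(pullback_connE B hA).
  rewrite (cd_sec_dpi _ Wo WP WY iP) (cd_sec_dpi _ Wo WP WX iP) -/i -/z XE YE lieE.
  rewrite (Defs.metric_sym hg _ (vcomp nabla P (Y P))).
  move: sg; rewrite -/i -/z /dpi /= => ->.
  rewrite opprB addrACA; apply/rowP => k; rewrite !mxE; ring.
rewrite (vcompD B hA hN) (vcompN B hA hN) !vcomp_warped !(pullback_connE B hA).
rewrite (cd_sec_vcomp _ Wo WP WY iP) (cd_sec_vcomp _ Wo WP WX iP) -/i -/z XE YE zE.
have -> : vcomp nabla P (@lie _ _ (TM A) X Y P) =
    ('d (in_chartTM i Y) z (X P) - 'd (in_chartTM i X) z (Y P)).2 +
    gam nabla i z.1 ('d (in_chartTM i Y) z (X P) - 'd (in_chartTM i X) z (Y P)).1 P.2.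
  by rewrite /vcomp /christoffel -gam_chart_at.
have gB u v w : gam nabla i z.1 (u - v) w =
    gam nabla i z.1 u w - gam nabla i z.1 v w.
  have := gam_linearl B hA hN (-1) v u w iP; rewrite !scaleN1r => e.
  by rewrite [u - v]addrC [RHS]addrC; exact: e.
have hX := gamTM_D (Y P).2 (gam nabla i z.1 (Y P).1 P.2) (X P).1 iP.
have hY := gamTM_D (X P).2 (gam nabla i z.1 (X P).1 P.2) (Y P).1 iP.
rewrite gB [gam nabla i z.1 (X P).1 (_ + _)]hX [gam nabla i z.1 (Y P).1 (_ + _)]hY.
have key := torsion_cancel ('d (in_chartTM i Y) z (X P)).2
  ('d (in_chartTM i X) z (Y P)).2
  (gam nabla i z.1 ('d (in_chartTM i Y) z (X P)).1 P.2)
  (gam nabla i z.1 ('d (in_chartTM i X) z (Y P)).1 P.2)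
  (gam nabla i z.1 (Y P).1 (X P).2) (gam nabla i z.1 (X P).1 (Y P).2) fl.
apply: etrans key.
set s1 := (X in X + _ + _ - _); set s2 := (X in _ - (X + _ + _)).
by apply/rowP => k; rewrite !mxE; ring.
Qed.

Lemma is_diff_conformal i Q : dom i Q.1 -> let z := chartTM i Q in
  is_diff z (fun y : E * E => expR (2 * (phi \o param i) y.1))
    (fun xi => f2 Q.1 * (2 * 'd (phi \o param i) (z.1) xi.1)).
Proof.
move=> iQ z.
have pd := differentiableP (phi_differentiable hphi iQ).
have d1 := is_diffZ_const (2 : R) (is_diff_comp (is_diff_fst z) pd).
have ex (t : R) : is_diff t expR (fun h => h * expR t).
  have ed : derivable (expR : R -> R) t 1 by case: (is_derive_expR t).
  split; first exact/derivable1_diffP.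
  by rewrite deriv1E // derive1E; case: (is_derive_expR t) => _ ->.
have [d dE] := is_diff_comp d1 (ex _).
split; first exact: d.
apply: (etrans dE); apply/funext => xi /=.
by rewrite chartK // mulrC.
Qed.

(** The derivative of f2 contributes 2 xi(phi), one half for each of the terms xi(phi)Y^v and
    xi(phi)Z^v. The terms Y(phi)xi^v and Z(phi)xi^v cancel against the gradient terms because f1
    delta = f2. *)
Lemma warped_metric W Y Z P xi : @aopen _ _ (TM A) W -> W P ->
  smooth_vf W Y -> smooth_vf W Z ->
  @vder _ _ (TM A) P xi (fun Q => G Q (Y Q) (Z Q)) =
  G P (warped P xi Y) (Z P) + G P (Y P) (warped P xi Z).
Proof.
move=> Wo WP WY WZ.
pose i := chart_at P.1; have iP : dom i P.1 := chart_at_dom hA P.1.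
pose z := chartTM i P.
have Y1d := sec_differentiable (smooth_sec_dpi B hA Wo WY) WP iP.
have Z1d := sec_differentiable (smooth_sec_dpi B hA Wo WZ) WP iP.
have Yvd := sec_differentiable (smooth_sec_vcomp B hA hN Wo WY) WP iP.
have Zvd := sec_differentiable (smooth_sec_vcomp B hA hN Wo WZ) WP iP.
have d1 := is_diffZ_const f1 (is_diff_gm iP Y1d Z1d).
have d2 := is_diffZ_vec (is_diff_conformal iP) (is_diff_gm iP Yvd Zvd).
have nn : {near z, (fun y => f1 * gm g i y.1 (sec i (Ypi Y) y) (sec i (Ypi Z) y) +
    expR (2 * (phi \o param i) y.1) *
      gm g i y.1 (sec i (Yv Y) y) (sec i (Yv Z) y)) =1
    (fun Q => G Q (Y Q) (Z Q)) \o paramTM i}.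
  apply: (near_chart (A := TM A) (i := i) Wo) => // Q iQ _.
  rewrite [RHS]/comp (paramK B hA) // !(secE B hA) // /weighted_metric.
  by rewrite !(metric_chart hA g _ _ iQ) /= chartK.
have [_ e] := near_eq_is_diff nn (is_diffD d1 d2).
apply: (etrans (congr1 (fun l => l xi) e)) => {e nn d1 d2}.
have dphi : 'd (phi \o param i) (z.1) xi.1 = vder P.1 (dpi P xi) phi by [].
have eY s : cd i z xi (sec i s) = pullback_conn nabla P xi s.
  by rewrite (pullback_connE B hA).
have es s : sec i s z = s P by rewrite (secE B hA) // coord_chart_at.
rewrite /weighted_metric !dpi_warped !vcomp_warped.
have lhs (u v : E) : gm g i z.1 u v = g P.1 u v by exact: gm_chart_at.
transitivity (f1 * (g P.1 (pullback_conn nabla P xi (Ypi Y)) (dpi P (Z P)) +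
      g P.1 (dpi P (Y P)) (pullback_conn nabla P xi (Ypi Z))) +
    (f2 P.1 * (2 * vder P.1 (dpi P xi) phi) *
       g P.1 (vcomp nabla P (Y P)) (vcomp nabla P (Z P)) +
     f2 P.1 * (g P.1 (pullback_conn nabla P xi (Yv Y)) (vcomp nabla P (Z P)) +
      g P.1 (vcomp nabla P (Y P)) (pullback_conn nabla P xi (Yv Z))))).
  rewrite -!eY -!dphi -[dpi P (Z P)](es (Ypi Z)) -[dpi P (Y P)](es (Ypi Y)).
  rewrite -[vcomp nabla P (Y P)](es (Yv Y)) -[vcomp nabla P (Z P)](es (Yv Z)).
  by rewrite -!lhs /= chartK.
have gP := gradP hA hg hphi P.1.
move: (pullback_conn _ _ _ (Ypi Y)) (pullback_conn _ _ _ (Ypi Z))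
  (pullback_conn _ _ _ (Yv Y)) (pullback_conn _ _ _ (Yv Z)) => a1 b1 av bv.
clear dphi eY; move: (vder P.1 (dpi P xi) phi) => dx.
rewrite -(gP (dpi P (Y P))) -(gP (dpi P (Z P))); move: (grad g phi P.1) => gr.
move: (dpi P (Y P)) (dpi P (Z P)) => y1 z1.
move: (vcomp nabla P (Y P)) (vcomp nabla P (Z P)) (vcomp nabla P xi) => yv zv xv.
rewrite !(metricDl hg, metricDr hg, metricNl hg, metricNr hg, metricZl hg, metricZr hg).
rewrite (Defs.metric_sym hg _ y1 gr) (Defs.metric_sym hg _ yv xv).
have f1n : f1 != 0 by rewrite gt_eqF.
by field.
Qed.

Lemma weighted_linearl P c xi eta zeta :
  G P (c *: xi + eta) zeta = c * G P xi zeta + G P eta zeta.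
Proof.
rewrite /weighted_metric.
have -> : vcomp nabla P (c *: xi + eta) = c *: vcomp nabla P xi + vcomp nabla P eta.
  exact: (vcomp_linear B hA hN).
have -> : dpi P (c *: xi + eta) = c *: dpi P xi + dpi P eta by [].
move: (vcomp nabla P xi) (vcomp nabla P eta) (vcomp nabla P zeta) => x y z.
move: (dpi P xi) (dpi P eta) (dpi P zeta) => x1 y1 z1.
by rewrite !(metric_linearl hg); ring.
Qed.

Lemma weighted_sym P xi eta : G P xi eta = G P eta xi.
Proof.
rewrite /weighted_metric (Defs.metric_sym hg _ (dpi P xi)).
by rewrite (Defs.metric_sym hg _ (vcomp nabla P xi)).
Qed.

Lemma weighted_definite P xi : G P xi xi = 0 -> xi = 0.
Proof.
have ge u : 0 <= g P.1 u u.
  have [->|u0] := eqVneq u 0; first by rewrite (metric0l hg).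
  exact/ltW/(metric_pos hg).
have gz u : g P.1 u u = 0 -> u = 0.
  move=> u0; apply/eqP/negPn/negP => /(metric_pos hg P.1).
  by rewrite u0 ltxx.
have h1 : 0 <= f1 * g P.1 (dpi P xi) (dpi P xi).
  by apply: mulr_ge0; [exact: ltW|exact: ge].
have h2 : 0 <= f2 P.1 * g P.1 (vcomp nabla P xi) (vcomp nabla P xi).
  by apply: mulr_ge0; [exact: expR_ge0|exact: ge].
rewrite /weighted_metric => /eqP; rewrite paddr_eq0 // !mulf_eq0.
rewrite (gt_eqF hf1) (gt_eqF (expR_gt0 _)) /=.
move=> /andP[/eqP /gz d0 /eqP /gz v0].
by apply: (tangent_ext (nabla := nabla) (P := P)); rewrite ?(vcomp0 B hA hN).
Qed.

(** * Identification of the Levi-Civita connection *)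

Section Uniqueness.
Variable nablaG : pt (TM A) -> E * E -> (pt (TM A) -> E * E) -> E * E.
Hypothesis hG : @levi_civita _ _ (TM A) G nablaG.

(* The usual braid: [T X Y Z = G (nablaG_X Y - warped_X Y, Z)] is symmetric in
   its first two arguments and antisymmetric in its last two. *)
Lemma nablaG_warped W X Y P : @aopen _ _ (TM A) W -> W P ->
  smooth_vf W X -> smooth_vf W Y -> nablaG P (X P) Y = warped P (X P) Y.
Proof.
move=> Wo WP WX WY.
pose S X Y := nablaG P (X P) Y - warped P (X P) Y.
pose T X Y Z := G P (S X Y) (Z P).
have T12 W' X' Y' Z' : @aopen _ _ (TM A) W' -> W' P ->
    smooth_vf W' X' -> smooth_vf W' Y' -> T X' Y' Z' = T Y' X' Z'.
  move=> W'o W'P sX sY.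
  suff e : S X' Y' = S Y' X' by exact: (congr1 (fun s => G P s (Z' P)) e).
  have := lc_torsion_free hG W'o W'P sX sY.
  rewrite -(warped_torsion W'o W'P sX sY) => e.
  move: e; rewrite /S; move: (nablaG P (X' P) Y') (nablaG P (Y' P) X').
  move: (warped P (X' P) Y') (warped P (Y' P) X') => a b c d e.
  have -> : c = a - b + d by rewrite -e subrK.
  by rewrite addrC !addrA addNr add0r addrC.
have T23 W' X' Y' Z' : @aopen _ _ (TM A) W' -> W' P ->
    smooth_vf W' Y' -> smooth_vf W' Z' -> T X' Y' Z' = - T X' Z' Y'.
  move=> W'o W'P sY sZ; rewrite /T /S.
  have := lc_metric hG (X' P) W'o W'P sY sZ.
  rewrite (warped_metric (X' P) W'o W'P sY sZ).
  have GB xi eta zeta : G P (xi - eta) zeta = G P xi zeta - G P eta zeta.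
    have := weighted_linearl P (-1) eta xi zeta; rewrite scaleN1r mulN1r => e.
    by rewrite [xi - _]addrC [RHS]addrC.
  move: (nablaG _ _ Y') (nablaG _ _ Z') (warped _ _ Y') (warped _ _ Z') => a b c d.
  move: (Y' P) (Z' P) => y z e; rewrite !GB.
  rewrite (weighted_sym P b) (weighted_sym P d) opprB.
  move: e; move: (G P a z) (G P c z) (G P y b) (G P y d) => ? ? ? ? ?; lra.
apply/eqP; rewrite -subr_eq0; apply/eqP; rewrite -/(S X Y).
apply: (weighted_definite (P := P)).
pose i := chart_at P.1; have iP : dom i P.1 := chart_at_dom hA P.1.
pose W' := W `&` [set Q | dom i Q.1].
have W'o : @aopen _ _ (TM A) W' := aopenI hT Wo (@aopen_dom _ _ (TM A) hT i).
have W'P : W' P by [].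
(* A field near P with value [S X Y] at P, so that [T X Y Z] is the squared G-norm of [S X Y].
   Coordinate fields are smooth on their chart domain, hence the restriction to W'. *)
pose Z := @vec _ _ (TM A) i (S X Y).
have sX : smooth_vf W' X by apply: smooth_vfS WX => Q [].
have sY : smooth_vf W' Y by apply: smooth_vfS WY => Q [].
have sZ : smooth_vf W' Z.
  by apply: smooth_vfS (smooth_vf_vec (pair_basis B B) hT i (S X Y)) => Q [].
have ZP : Z P = S X Y by exact: (vec_chart_at hT).
(* Six alternating swaps return the arguments to their original order and accumulate three signs. *)
have TT : T X Y Z = - T X Y Z.
  rewrite {1}(T12 W' X Y Z) // (T23 W' Y X Z) // (T12 W' Y Z X) //.
  by rewrite (T23 W' Z Y X) // (T12 W' Z X Y) // (T23 W' X Z Y) // !opprK.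
move: TT; rewrite /T ZP => /eqP; rewrite -subr_eq0 opprK -mulr2n mulrn_eq0 /=.
by move/eqP.
Qed.
(** In the curvature, the bracket occurs as a single vector at P; extending it to a coordinate field
    brings it under the previous lemma. *)
Lemma nablaG_warped_at W xi Y P : @aopen _ _ (TM A) W -> W P ->
  smooth_vf W Y -> nablaG P xi Y = warped P xi Y.
Proof.
move=> Wo WP WY.
pose i := chart_at P.1; have iP : dom i P.1 := chart_at_dom hA P.1.
pose W' := W `&` [set Q | dom i Q.1].
have W'o : @aopen _ _ (TM A) W' := aopenI hT Wo (@aopen_dom _ _ (TM A) hT i).
have W'P : W' P by [].
have sX : smooth_vf W' (@vec _ _ (TM A) i xi).
  by apply: smooth_vfS (smooth_vf_vec (pair_basis B B) hT i xi) => Q [].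
have sY : smooth_vf W' Y by apply: smooth_vfS WY => Q [].
have XP : @vec _ _ (TM A) i xi P = xi by exact: (vec_chart_at hT).
by have := nablaG_warped W'o W'P sX sY; rewrite XP.
Qed.

(** * The gradient as a section, and the Hessian of the potential *)

Local Notation gradS := (fun Q : pt (TM A) => grad g phi Q.1).
Local Notation nab := (pullback_conn nabla).

Lemma sec_grad i Q : dom i Q.1 ->
  sec i gradS (chartTM i Q) = in_chart i (grad g phi) (chart i Q.1).
Proof.
move=> iQ; have e1 := secE B hA gradS iQ.
have e2 := in_chartE hA (grad g phi) iQ.
exact: (etrans e1 (esym e2)).
Qed.

Lemma sec_grad_differentiable i Q : dom i Q.1 ->
  differentiable (sec i gradS) (chartTM i Q).
Proof.
move=> iQ.
have hd := differentiableP (grad_differentiable hA hg hphi iQ).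
have [d _] := is_diff_comp (is_diff_fst (chartTM i Q)) hd.
apply: near_eq_differentiable d.
apply: (near_chart (A := TM A) (i := i) (@aopen_dom _ _ (TM A) hT i) iQ iQ) => Q' iQ' _.
exact: (esym (sec_grad iQ')).
Qed.

Lemma dphi_sec i Q (v : E) : dom i Q.1 ->
  'd (phi \o param i) (chart i Q.1) v =
  gm g i (chart i Q.1) (sec i gradS (chartTM i Q)) v.
Proof. by move=> iQ; rewrite sec_grad // gm_grad. Qed.

(** Writing dphi(s) as g(grad phi, s) lets metric compatibility produce the Hessian term and the
    covariant derivative of s. The functions Y(phi) and Z(phi) are differentiated this way. *)
Lemma is_diff_dphi P (s : E * E -> E) :
  let i := chart_at P.1 in let z := chartTM i P in differentiable s z ->
  is_diff z (fun y => 'd (phi \o param i) (y.1) (s y))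
   (fun xi => g P.1 (nab P xi gradS) (s z) + g P.1 (grad g phi P.1) (cd i z xi s)).
Proof.
move=> i z sd; have iP : dom i P.1 := chart_at_dom hA P.1.
have nn : {near z, (fun y => gm g i y.1 (sec i gradS y) (s y)) =1
    (fun y => 'd (phi \o param i) (y.1) (s y))}.
  apply: (near_chart (A := TM A) (i := i) (@aopen_dom _ _ (TM A) hT i)) => // Q iQ _.
  exact: (esym (dphi_sec _ iQ)).
have [d e] := near_eq_is_diff nn (is_diff_gm iP (sec_grad_differentiable iP) sd).
split; first exact: d.
apply: (etrans e); apply/funext => xi.
rewrite (pullback_connE B hA) -/i -/z -!gm_chart_at -/i.
by rewrite sec_grad // in_chartE // coord_chart_at.
Qed.

(** Differentiating dphi on a section with constant components in two ways gives Hess(u, v) = D_u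
    D_v phi - dphi(Gamma(u, v)), which is symmetric by Schwarz and the symmetry of Gamma. *)
Lemma hessian_sym P xi eta :
  g P.1 (nab P xi gradS) (dpi P eta) = g P.1 (nab P eta gradS) (dpi P xi).
Proof.
pose i := chart_at P.1; have iP : dom i P.1 := chart_at_dom hA P.1.
pose z := chartTM i P.
have ps := phi_smooth hphi i.
have io := img_open i (aopen_dom hA i).
have iz : img i (dom i) z.1 := img_chart iP iP.
have key u v : g P.1 (nab P u gradS) (dpi P v) =
    'D_(u.1) ('D_(v.1) (phi \o param i)) z.1 -
    g P.1 (grad g phi P.1) (gam nabla i z.1 u.1 v.1).
  have [_ e1] := is_diff_diff B io iz ps (is_diff_fst z) (is_diff_cst v.1 z).
  have [_ e2] := is_diff_dphi (P := P) (differentiable_cst (v.1 : E) z).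
  have e : g P.1 (nab P u gradS) v.1 + g P.1 (grad g phi P.1) (cd i z u (cst v.1)) =
      'd ('D_(v.1) (phi \o param i)) (z.1) u.1 + 'd (phi \o param i) (z.1) 0.
    exact: (etrans (esym (congr1 (fun l => l u) e2)) (congr1 (fun l => l u) e1)).
  have cdE : cd i z u (cst v.1) = gam nabla i z.1 u.1 v.1.
    apply: (etrans (congr1 (fun l => l u + gam nabla i z.1 u.1 v.1) (diff_cst v.1 z))).
    by rewrite add0r.
  have dE := deriveE u.1 (smooth_on_differentiable (smooth_on_derive v.1 ps) iz).
  move: e; rewrite cdE linear0 addr0 => e.
  by rewrite dE -e addrK.
apply: (etrans (key xi eta)); apply: (etrans _ (esym (key eta xi))).
have sw := Schwarz_real xi.1 eta.1 io iz (ps 2%N).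
have sg := gam_sym B hA hnabla P.1 xi.1 eta.1.
exact: (congr2 (fun a b => a - g P.1 (grad g phi P.1) b) sw sg).
Qed.


(** * Second covariant derivatives *)

Local Notation delta := (fun p => f2 p / f1).
Local Notation DG Y Z := (fun Q => nablaG Q (Y Q) Z).

(** The inner derivative is kept in the form [nablaG]: its smoothness is then an axiom of
    connections, and the formula applies to it a second time. *)
Lemma smooth_DG W Y Z : @aopen _ _ (TM A) W -> smooth_vf W Y -> smooth_vf W Z ->
  smooth_vf W (DG Y Z).
Proof. exact: (conn_smooth (lc_connection hG)). Qed.

(** To be differentiated at P, the formula is needed at all nearby Q in one chart i, although it is
    stated in the preferred chart of each Q; [coord_pullback] makes the change of chart. *)
Lemma sec_dpi_DG i W Y Z Q : @aopen _ _ (TM A) W -> W Q ->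
  smooth_vf W Y -> smooth_vf W Z -> dom i Q.1 -> let y := chartTM i Q in
  sec i (Ypi (DG Y Z)) y =
  cd i y (in_chartTM i Y y) (sec i (Ypi Z))
  - ((f1^-1 * expR (2 * (phi \o param i) y.1)) *
     gm g i y.1 (sec i (Yv Y) y) (sec i (Yv Z) y)) *: sec i gradS y.
Proof.
move=> Wo WQ WY WZ iQ y.
have nE := nablaG_warped Wo WQ WY WZ.
apply: (etrans (secE B hA (Ypi (DG Y Z)) iQ)).
rewrite nE dpi_warped; set a := pullback_conn _ _ _ _.
have aE : coord i Q.1 a = cd i y (in_chartTM i Y y) (sec i (Ypi Z)).
  rewrite (in_chartE hT Y (i := i) (p := Q)) //.
  exact: (coord_pullback B hA hN _ Wo WQ (smooth_sec_dpi B hA Wo WZ) iQ).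
have cB c (u v : E) : coord i Q.1 (u - c *: v) =
    coord i Q.1 u - c *: coord i Q.1 v.
  by rewrite -scaleNr addrC coordD coordZ scaleNr addrC.
rewrite cB aE (metric_chart hA g _ _ iQ).
have -> := secE B hA (Yv Y) iQ; have -> := secE B hA (Yv Z) iQ.
have -> := secE B hA gradS iQ.
by rewrite /= chartK // [f1^-1 * _]mulrC.
Qed.

Lemma sec_vcomp_DG i W Y Z Q : @aopen _ _ (TM A) W -> W Q ->
  smooth_vf W Y -> smooth_vf W Z -> dom i Q.1 -> let y := chartTM i Q in
  sec i (Yv (DG Y Z)) y =
  cd i y (in_chartTM i Y y) (sec i (Yv Z))
  + 'd (phi \o param i) (y.1) (sec i (Ypi Y) y) *: sec i (Yv Z) y
  + 'd (phi \o param i) (y.1) (sec i (Ypi Z) y) *: sec i (Yv Y) y.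
Proof.
move=> Wo WQ WY WZ iQ y.
have nE := nablaG_warped Wo WQ WY WZ.
apply: (etrans (secE B hA (Yv (DG Y Z)) iQ)).
rewrite nE vcomp_warped; set a := pullback_conn _ _ _ _.
have aE : coord i Q.1 a = cd i y (in_chartTM i Y y) (sec i (Yv Z)).
  rewrite (in_chartE hT Y (i := i) (p := Q)) //.
  exact: (coord_pullback B hA hN _ Wo WQ (smooth_sec_vcomp B hA hN Wo WZ) iQ).
clearbody a; rewrite 2!coordD 2!coordZ aE.
have -> := secE B hA (Yv Y) iQ; have -> := secE B hA (Yv Z) iQ.
have -> := secE B hA (Ypi Y) iQ; have -> := secE B hA (Ypi Z) iQ.
have vE v := vder_chart hA v iQ (phi_differentiable hphi iQ).
have e1 := vE (dpi Q (Y Q)); have e2 := vE (dpi Q (Z Q)).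
by rewrite e1 e2.
Qed.


Lemma sec_at P s : sec (chart_at P.1) s (chartTM (chart_at P.1) P) = s P.
Proof.
exact: (etrans (secE B hA s (chart_at_dom hA P.1)) (coord_chart_at hA P.1 (s P))).
Qed.

Lemma is_diff_section W Y i Q : @aopen _ _ (TM A) W -> W Q -> smooth_vf W Y ->
  dom i Q.1 -> differentiable (sec i (Ypi Y)) (chartTM i Q) /\
  differentiable (sec i (Yv Y)) (chartTM i Q).
Proof.
move=> Wo WQ WY iQ; split.
  exact: (sec_differentiable (smooth_sec_dpi B hA Wo WY) WQ iQ).
exact: (sec_differentiable (smooth_sec_vcomp B hA hN Wo WY) WQ iQ).
Qed.

Lemma cd_sec_differentiable W Y P s : @aopen _ _ (TM A) W -> W P ->
  smooth_vf W Y -> smooth_sec W s -> let i := chart_at P.1 in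
  differentiable (fun y => cd i y (in_chartTM i Y y) (sec i s)) (chartTM i P).
Proof.
move=> Wo WP WY Ws i; have iP : dom i P.1 := chart_at_dom hA P.1.
have Vo := @imgTM_open _ _ A i W Wo.
have Vz := @img_chart _ _ (TM A) i W P iP WP.
have Yd := differentiableP (in_chartTM_differentiable WY WP iP).
by have [] := is_diff_cd B hA hN iP Vo Vz (Ws i) Yd.
Qed.

(** The iterated derivative of the section of Z stays as a nested [cd], the form in which [nab_flat]
    cancels it; the remaining terms are the Leibniz rule for delta, g(Y^v, Z^v) and grad phi. *)
Lemma nab_dpi_DG W Y Z P xi : @aopen _ _ (TM A) W -> W P ->
  smooth_vf W Y -> smooth_vf W Z ->
  let i := chart_at P.1 in let z := chartTM i P in let h := g P.1 in
  let y := vcomp nabla P (Y P) in let w := vcomp nabla P (Z P) in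
  nab P xi (Ypi (DG Y Z)) =
  cd i z xi (fun y => cd i y (in_chartTM i Y y) (sec i (Ypi Z)))
  - ((delta P.1 * (2 * vder P.1 (dpi P xi) phi) * h y w
      + delta P.1 * (h (nab P xi (Yv Y)) w + h y (nab P xi (Yv Z))))
       *: grad g phi P.1
     + (delta P.1 * h y w) *: nab P xi gradS).
Proof.
move=> Wo WP WY WZ i z h y w; have iP : dom i P.1 := chart_at_dom hA P.1.
have [_ Yvd] := is_diff_section Wo WP WY iP.
have [_ Zvd] := is_diff_section Wo WP WZ iP.
pose F x := cd i x (in_chartTM i Y x) (sec i (Ypi Z)).
(* The minus sign goes into the coefficient, so that the section is a plain sum to which [cdD] and
   [cdZ] apply. *)
pose c x : R := (- f1^-1 * expR (2 * (phi \o param i) x.1)) *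
  gm g i x.1 (sec i (Yv Y) x) (sec i (Yv Z) x).
have Fd : differentiable F z.
  exact: (cd_sec_differentiable Wo WP WY (smooth_sec_dpi B hA Wo WZ)).
have [cd_ cE] := is_diffZ_vec (is_diffZ_const (- f1^-1) (is_diff_conformal iP))
  (is_diff_gm iP Yvd Zvd).
have cdif : differentiable c z by exact: cd_.
have sd := sec_grad_differentiable iP.
have nn : {near z, (fun x => F x + c x *: sec i gradS x) =1 sec i (Ypi (DG Y Z))}.
  apply: (near_chart (A := TM A) (i := i) Wo WP iP) => Q iQ WQ.
  apply: (etrans _ (esym (sec_dpi_DG Wo WQ WY WZ iQ))).
  by rewrite /F /c -scaleNr !mulNr.
have csd : differentiable (fun x => c x *: sec i gradS x) z.
  by case: (is_diffZ_vec (differentiableP cdif) (differentiableP sd)).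
have FD := differentiableD Fd csd.
apply: (etrans (pullback_connE B hA nabla P xi _)).
apply: (etrans (@cd_near _ _ _ nabla i z xi
  (fun x => F x + c x *: sec i gradS x) _ nn FD)).
apply: (etrans (cdD B hA hN xi iP Fd csd)).
have e2 := cdZ B hA hN xi iP cdif sd.
have e3 : 'd c z xi =
    - f1^-1 * (f2 P.1 * (2 * vder P.1 (dpi P xi) phi)) *
      gm g i z.1 (sec i (Yv Y) z) (sec i (Yv Z) z) +
    - f1^-1 * expR (2 * (phi \o param i) z.1) *
      (gm g i z.1 (cd i z xi (sec i (Yv Y))) (sec i (Yv Z) z)
       + gm g i z.1 (sec i (Yv Y) z) (cd i z xi (sec i (Yv Z)))).
  exact: (congr1 (fun l => l xi) cE).
have pE : (phi \o param i) z.1 = phi P.1 by rewrite /= chartK.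
apply: (etrans (congr1 (fun t => cd i z xi F + t) e2)).
apply: (etrans (congr1 (fun t => cd i z xi F +
  (t *: sec i gradS z + c z *: cd i z xi (sec i gradS))) e3)).
have cdP s : cd i z xi (sec i s) = nab P xi s := esym (pullback_connE B hA nabla P xi s).
have gmP (u v : E) : gm g i z.1 u v = h u v by exact: gm_chart_at.
rewrite /c !cdP !sec_at !gmP pE -/y -/w -/F.
move: (cd i z xi F) (nab P xi gradS) (nab P xi (Yv Y)) (nab P xi (Yv Z)).
move: (vder P.1 (dpi P xi) phi) (grad g phi P.1) => d gr a b ay aw.
by apply/rowP => k; rewrite !mxE; ring.
Qed.


(** The coefficients Y(phi) and Z(phi) are functions on TM; their derivatives by [is_diff_dphi]
    bring the Hessian into the curvature. *)
Lemma nab_vcomp_DG W Y Z P xi : @aopen _ _ (TM A) W -> W P ->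
  smooth_vf W Y -> smooth_vf W Z ->
  let i := chart_at P.1 in let z := chartTM i P in let h := g P.1 in
  let gr := grad g phi P.1 in
  nab P xi (Yv (DG Y Z)) =
  cd i z xi (fun y => cd i y (in_chartTM i Y y) (sec i (Yv Z)))
  + ((h (nab P xi gradS) (dpi P (Y P)) + h gr (nab P xi (Ypi Y)))
       *: vcomp nabla P (Z P)
     + vder P.1 (dpi P (Y P)) phi *: nab P xi (Yv Z))
  + ((h (nab P xi gradS) (dpi P (Z P)) + h gr (nab P xi (Ypi Z)))
       *: vcomp nabla P (Y P)
     + vder P.1 (dpi P (Z P)) phi *: nab P xi (Yv Y)).
Proof.
move=> Wo WP WY WZ i z h gr; have iP : dom i P.1 := chart_at_dom hA P.1.
have [Y1d Yvd] := is_diff_section Wo WP WY iP.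
have [Z1d Zvd] := is_diff_section Wo WP WZ iP.
pose F x := cd i x (in_chartTM i Y x) (sec i (Yv Z)).
pose c (s : pt (TM A) -> E) (x : E * E) := 'd (phi \o param i) (x.1) (sec i s x).
have Fd : differentiable F z.
  exact: (cd_sec_differentiable Wo WP WY (smooth_sec_vcomp B hA hN Wo WZ)).
have [cYd cYE] := is_diff_dphi (P := P) Y1d.
have [cZd cZE] := is_diff_dphi (P := P) Z1d.
have nn : {near z, (fun x => F x + c (Ypi Y) x *: sec i (Yv Z) x
     + c (Ypi Z) x *: sec i (Yv Y) x) =1 sec i (Yv (DG Y Z))}.
  apply: (near_chart (A := TM A) (i := i) Wo WP iP) => Q iQ WQ.
  exact: (esym (sec_vcomp_DG Wo WQ WY WZ iQ)).
have d1 : differentiable (fun x => c (Ypi Y) x *: sec i (Yv Z) x) z.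
  by case: (is_diffZ_vec (differentiableP cYd) (differentiableP Zvd)).
have d2 : differentiable (fun x => c (Ypi Z) x *: sec i (Yv Y) x) z.
  by case: (is_diffZ_vec (differentiableP cZd) (differentiableP Yvd)).
have D1 : differentiable (fun x => F x + c (Ypi Y) x *: sec i (Yv Z) x) z.
  exact: (differentiableD Fd d1).
have D2 : differentiable (fun x => F x + c (Ypi Y) x *: sec i (Yv Z) x
    + c (Ypi Z) x *: sec i (Yv Y) x) z.
  exact: (differentiableD D1 d2).
have cdP s : cd i z xi (sec i s) = nab P xi s := esym (pullback_connE B hA nabla P xi s).
have cP s : c s z = vder P.1 (s P) phi.
  exact: (congr1 (fun v => 'd (phi \o param i) (z.1) v) (sec_at P s)).
have dc s (sE : 'd (c s) z = (fun xi => h (nab P xi gradS) (sec i s z)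
     + h gr (cd i z xi (sec i s))) :> (E * E -> R)) :
    'd (c s) z xi = h (nab P xi gradS) (s P) + h gr (nab P xi s).
  by apply: (etrans (congr1 (fun l => l xi) sE)); rewrite cdP sec_at.
have e1 := cdZ B hA hN xi iP cYd Zvd.
have e2 := cdZ B hA hN xi iP cZd Yvd.
have e1' := etrans e1 (congr1 (fun t => t *: sec i (Yv Z) z
  + c (Ypi Y) z *: cd i z xi (sec i (Yv Z))) (dc _ cYE)).
have e2' := etrans e2 (congr1 (fun t => t *: sec i (Yv Y) z
  + c (Ypi Z) z *: cd i z xi (sec i (Yv Y))) (dc _ cZE)).
apply: (etrans (pullback_connE B hA nabla P xi _)).
apply: (etrans (@cd_near _ _ _ nabla i z xi (fun x => F x +
  c (Ypi Y) x *: sec i (Yv Z) x + c (Ypi Z) x *: sec i (Yv Y) x) _ nn D2)).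
apply: (etrans (cdD B hA hN xi iP D1 d2)).
apply: (etrans (congr2 (fun a b => a + b) (etrans (cdD B hA hN xi iP Fd d1)
  (congr1 (fun t => cd i z xi F + t) e1')) e2')).
by rewrite /= !cdP !sec_at !cP.
Qed.

Lemma nab_zero P xi : nab P xi (fun=> 0) = 0.
Proof.
pose i := chart_at P.1; have iP : dom i P.1 := chart_at_dom hA P.1.
apply: (etrans (pullback_connE B hA nabla P xi _)); rewrite -/i.
have s0 : sec i (fun=> 0 : E) = cst 0.
  by apply/funext => x; rewrite /sec /Defs.coord linear0.
rewrite s0.
apply: (etrans (congr1 (fun l => l xi + gam nabla i (chart i P.1) xi.1 0)
  (diff_cst (0 : E) (chartTM i P)))).
rewrite add0r; have := gamTM_D 0 0 xi.1 iP; rewrite addr0 => /esym.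
by move/(congr1 (fun y => y - gam nabla i (chart i P.1) xi.1 0));
  rewrite addrK subrr.
Qed.

Lemma conn_HV_gradS P xi (gradH := fun Q => hlift nabla Q (grad g phi Q.1)) :
  dpi P (conn_HV nabla P xi gradH) = nab P xi gradS /\
  vcomp nabla P (conn_HV nabla P xi gradH) = 0.
Proof.
split; first by rewrite /conn_HV /dpi /= addr0.
rewrite /conn_HV (vcompD B hA hN) vcomp_hlift (vcomp_vlift B hA hN) add0r.
have -> : (fun Q => vcomp nabla Q (gradH Q)) = (fun=> 0).
  by apply/funext => Q; rewrite vcomp_hlift.
exact: nab_zero.
Qed.

Lemma nab_flat W X Y P s : @aopen _ _ (TM A) W -> W P ->
  smooth_vf W X -> smooth_vf W Y -> smooth_sec W s ->
  let i := chart_at P.1 in let z := chartTM i P in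
  cd i z (X P) (fun y => cd i y (in_chartTM i Y y) (sec i s))
  - cd i z (Y P) (fun y => cd i y (in_chartTM i X y) (sec i s))
  = nab P (@lie _ _ (TM A) X Y P) s.
Proof.
move=> Wo WP WX WY Ws i z; have iP : dom i P.1 := chart_at_dom hA P.1.
have Xd := in_chartTM_differentiable WX WP iP.
have Yd := in_chartTM_differentiable WY WP iP.
have Vo := @imgTM_open _ _ A i W Wo.
have Vz := @img_chart _ _ (TM A) i W P iP WP.
have := cd_flat B hA hN hflat Vo Vz (Ws i) Xd Yd.
rewrite -/i -/z (in_chartTM_at X) (in_chartTM_at Y) => e.
apply: (etrans e); exact: (esym (pullback_connE B hA nabla P _ s)).
Qed.


(** * Algebra of the horizontal and vertical components *)

Section Algebra.
Variable h : E -> E -> R.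
Hypothesis hl : forall c u v w, h (c *: u + v) w = c * h u w + h v w.
Hypothesis hs : forall u v, h u v = h v u.

Let hlD u v w : h (u + v) w = h u w + h v w.
Proof. by have := hl 1 u v w; rewrite scale1r mul1r. Qed.

Let hl0 w : h 0 w = 0.
Proof. by have := hlD 0 0 w; rewrite addr0; lra. Qed.

Let hlZ c u w : h (c *: u) w = c * h u w.
Proof. by have := hl c u 0 w; rewrite addr0 hl0 addr0. Qed.

Let hlN u w : h (- u) w = - h u w.
Proof. by rewrite -scaleN1r hlZ mulN1r. Qed.

Let hrD u v w : h w (u + v) = h w u + h w v.
Proof. by rewrite !(hs w) hlD. Qed.

Let hrZ c u w : h w (c *: u) = c * h w u.
Proof. by rewrite !(hs w) hlZ. Qed.

Let hrN u w : h w (- u) = - h w u.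
Proof. by rewrite !(hs w) hlN. Qed.

(** Here d is delta, dx is X(phi), axy is the derivative of Y^v along X, gX that of grad phi, and a,
    b are the iterated derivatives. The factor 2 from differentiating delta drops to 1 because
    X(phi)Z^v inside the other second derivative gives one copy back; the terms in dz cancel by
    symmetry of h. *)
Lemma horizontal_curvature d dx dy dz (xv yv zv a b axy ayx axz ayz gr gX gY : E) :
  a - ((d * (2 * dx) * h yv zv + d * (h axy zv + h yv axz)) *: gr
       + (d * h yv zv) *: gX)
    - (d * h xv (ayz + dy *: zv + dz *: yv)) *: gr
  - (b - ((d * (2 * dy) * h xv zv + d * (h ayx zv + h xv ayz)) *: gr
          + (d * h xv zv) *: gY)
       - (d * h yv (axz + dx *: zv + dz *: xv)) *: gr)
  - (a - b - (d * h (axy - ayx) zv) *: gr)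
  = - ((d * (dx * h yv zv - dy * h xv zv)) *: gr) - (d * h yv zv) *: gX
    + (d * h xv zv) *: gY.
Proof.
rewrite !(hlD, hlN, hrD, hrZ) (hs yv xv).
by apply/rowP => k; rewrite !mxE; ring.
Qed.

(** Names as before, with bxy the derivative along X of the horizontal part of Y. Hessian symmetry
    removes the Hessian terms along Z^v, and delta epsilon^2 arises from dphi applied to the
    gradient term of the inner derivative. *)
Lemma vertical_curvature d dx dy dz
    (x1 y1 z1 xv yv zv a b bxy byx bxz byz axy ayx axz ayz gr gX gY : E) :
  h gX y1 = h gY x1 ->
  a + ((h gX y1 + h gr bxy) *: zv + dy *: axz)
    + ((h gX z1 + h gr bxz) *: yv + dz *: axy)
    + dx *: (ayz + dy *: zv + dz *: yv)
    + h gr (byz - (d * h yv zv) *: gr) *: xv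
  - (b + ((h gY x1 + h gr byx) *: zv + dx *: ayz)
       + ((h gY z1 + h gr byz) *: xv + dz *: ayx)
       + dy *: (axz + dx *: zv + dz *: xv)
       + h gr (bxz - (d * h xv zv) *: gr) *: yv)
  - (a - b + h gr (bxy - byx) *: zv + dz *: (axy - ayx))
  = (dx * dz + d * h gr gr * h xv zv + h gX z1) *: yv
    - (dy * dz + d * h gr gr * h yv zv + h gY z1) *: xv.
Proof.
move=> sym; rewrite sym !(hrD, hrN, hrZ).
by apply/rowP => k; rewrite !mxE; ring.
Qed.

End Algebra.

(** The terms in phi and delta of [warped] are symmetric, so its torsion-freeness gives that of
    pi^*nabla (+) pi^*nabla, and the bracket can be eliminated from the curvature. *)
Lemma lie_components W X Y P : @aopen _ _ (TM A) W -> W P ->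
  smooth_vf W X -> smooth_vf W Y ->
  dpi P (@lie _ _ (TM A) X Y P) = nab P (X P) (Ypi Y) - nab P (Y P) (Ypi X) /\
  vcomp nabla P (@lie _ _ (TM A) X Y P) = nab P (X P) (Yv Y) - nab P (Y P) (Yv X).
Proof.
move=> Wo WP WX WY; rewrite -(warped_torsion Wo WP WX WY); split.
  have -> : dpi P (warped P (X P) Y - warped P (Y P) X) =
    dpi P (warped P (X P) Y) - dpi P (warped P (Y P) X) by [].
  rewrite !dpi_warped (Defs.metric_sym hg _ (vcomp nabla P (Y P))).
  by rewrite opprB addrA subrK.
rewrite (vcompD B hA hN) (vcompN B hA hN) !vcomp_warped.
move: (nab _ _ _) (nab _ _ _) => a b.
move: (vcomp _ _ _) (vcomp _ _ _) (vder _ _ _) (vder _ _ _) => x y c d.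
by apply/rowP => k; rewrite !mxE; ring.
Qed.

Lemma curvature_warped W X Y Z P (gradH := fun Q => hlift nabla Q (grad g phi Q.1))
    (N := conn_HV nabla) (v := vpart nabla) (br := sasaki g nabla)
    (D := fun (P : pt (TM A)) xi => vder P.1 (dpi P xi) phi)
    (eps := fun P : pt (TM A) => Num.sqrt (g P.1 (grad g phi P.1) (grad g phi P.1))) :
  @aopen _ _ (TM A) W -> W P ->
  smooth_vf W X -> smooth_vf W Y -> smooth_vf W Z ->
  @curvature _ _ (TM A) nablaG X Y Z P
     = (D P (X P) * D P (Z P)
          + delta P.1 * eps P ^+ 2 * br P (v P (X P)) (v P (Z P))
          + br P (N P (X P) gradH) (Z P)) *: v P (Y P)
       - (D P (Y P) * D P (Z P)
          + delta P.1 * eps P ^+ 2 * br P (v P (Y P)) (v P (Z P))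
          + br P (N P (Y P) gradH) (Z P)) *: v P (X P)
       - (delta P.1 * (D P (X P) * br P (v P (Y P)) (v P (Z P))
                   - D P (Y P) * br P (v P (X P)) (v P (Z P)))) *: gradH P
       - (delta P.1 * br P (v P (Y P)) (v P (Z P))) *: N P (X P) gradH
       + (delta P.1 * br P (v P (X P)) (v P (Z P))) *: N P (Y P) gradH.
Proof.
move=> Wo WP WX WY WZ.
have [nX1 nXv] := conn_HV_gradS P (X P).
have [nY1 nYv] := conn_HV_gradS P (Y P).
have brN NX : vcomp nabla P NX = 0 -> br P NX (Z P) = g P.1 (dpi P NX) (dpi P (Z P)).
  move=> nx; rewrite /br /sasaki /weighted_metric nx (metric0l hg).
  by rewrite mulr0 addr0 mul1r.
have eps2 : eps P ^+ 2 = g P.1 (grad g phi P.1) (grad g phi P.1).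
  rewrite sqr_sqrtr //; have [->|u0] := eqVneq (grad g phi P.1) 0.
    by rewrite (metric0l hg).
  exact/ltW/(metric_pos hg).
have brv xi eta : br P (v P xi) (v P eta) = g P.1 (vcomp nabla P xi) (vcomp nabla P eta).
  by rewrite /br sasaki_vpart (vcomp_vpart B hA hN).
rewrite (brN _ nXv) (brN _ nYv) nX1 nY1 eps2 !brv.
have [l1 lv] := lie_components Wo WP WX WY.
have wXYZ := nablaG_warped Wo WP WX (smooth_DG Wo WY WZ).
have wYXZ := nablaG_warped Wo WP WY (smooth_DG Wo WX WZ).
have wL := nablaG_warped_at (@lie _ _ (TM A) X Y P) Wo WP WZ.
have cE : @curvature _ _ (TM A) nablaG X Y Z P =
    warped P (X P) (DG Y Z) - warped P (Y P) (DG X Z)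
    - warped P (@lie _ _ (TM A) X Y P) Z.
  by rewrite /curvature wXYZ wYXZ wL.
have fl1 := nab_flat Wo WP WX WY (smooth_sec_dpi B hA Wo WZ).
have flv := nab_flat Wo WP WX WY (smooth_sec_vcomp B hA hN Wo WZ).
have vN xi eta : vcomp nabla P (xi - eta) = vcomp nabla P xi - vcomp nabla P eta.
  by rewrite (vcompD B hA hN) (vcompN B hA hN).
have nYZ : nablaG P (Y P) Z = warped P (Y P) Z := nablaG_warped Wo WP WY WZ.
have nXZ : nablaG P (X P) Z = warped P (X P) Z := nablaG_warped Wo WP WX WZ.
have hsym := hessian_sym P (X P) (Y P).
have gr1 : dpi P (gradH P) = grad g phi P.1 by [].
have grv : vcomp nabla P (gradH P) = 0 by exact: vcomp_hlift.
have vp xi : dpi P (v P xi) = 0 by [].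
have vv xi : vcomp nabla P (v P xi) = vcomp nabla P xi by exact: (vcomp_vpart B hA hN).
rewrite cE; apply: (tangent_ext (nabla := nabla) (P := P)).
  have dL a b c : dpi P (a - b - c) = dpi P a - dpi P b - dpi P c by [].
  have dR (c1 c2 c3 c4 c5 : R) a b c d e :
    dpi P (c1 *: a - c2 *: b - c3 *: c - c4 *: d + c5 *: e) = c1 *: dpi P a
      - c2 *: dpi P b - c3 *: dpi P c - c4 *: dpi P d + c5 *: dpi P e by [].
  apply: (etrans (dL _ _ _)); apply: (etrans _ (esym (dR _ _ _ _ _ _ _ _ _ _))).
  have e1 := dpi_warped P (X P) (DG Y Z).
  have e2 := dpi_warped P (Y P) (DG X Z).
  have e3 := dpi_warped P (@lie _ _ (TM A) X Y P) Z.
  (* The derivative along the bracket becomes the commutator of the iterated derivatives, which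
     cancels those produced by [e1] and [e2]. *)
  rewrite -fl1 lv in e3.
  rewrite nYZ (vcomp_warped P (Y P) Z) (nab_dpi_DG (X P) Wo WP WY WZ) in e1.
  rewrite nXZ (vcomp_warped P (X P) Z) (nab_dpi_DG (Y P) Wo WP WX WZ) in e2.
  rewrite e1 e2 e3 nX1 nY1 !vp gr1 !scaler0 subr0 sub0r.
  exact: (horizontal_curvature (metric_linearl hg P.1) (Defs.metric_sym hg P.1)).
have vL a b c : vcomp nabla P (a - b - c) =
  vcomp nabla P a - vcomp nabla P b - vcomp nabla P c by rewrite !vN.
have vR (c1 c2 c3 c4 c5 : R) a b c d e :
    vcomp nabla P (c1 *: a - c2 *: b - c3 *: c - c4 *: d + c5 *: e) =
      c1 *: vcomp nabla P a - c2 *: vcomp nabla P b - c3 *: vcomp nabla P c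
      - c4 *: vcomp nabla P d + c5 *: vcomp nabla P e.
  by rewrite (vcompD B hA hN) !vN !(vcompZ B hA hN).
apply: (etrans (vL _ _ _)); apply: (etrans _ (esym (vR _ _ _ _ _ _ _ _ _ _))).
have e1 := vcomp_warped P (X P) (DG Y Z).
have e2 := vcomp_warped P (Y P) (DG X Z).
have e3 := vcomp_warped P (@lie _ _ (TM A) X Y P) Z.
(* As in the horizontal part; moreover [X, Y](phi) is rewritten as g(grad phi, .) so that it splits
   over the two components of the bracket. *)
rewrite -flv lv l1 -(gradP hA hg hphi P.1 (_ - _)) in e3.
rewrite nYZ (vcomp_warped P (Y P) Z) (dpi_warped P (Y P) Z)
  (nab_vcomp_DG (X P) Wo WP WY WZ) -(gradP hA hg hphi P.1 (_ - _)) in e1.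
rewrite nXZ (vcomp_warped P (X P) Z) (dpi_warped P (X P) Z)
  (nab_vcomp_DG (Y P) Wo WP WX WZ) -(gradP hA hg hphi P.1 (_ - _)) in e2.
rewrite e1 e2 e3 nXv nYv grv !vv !scaler0 !subr0 addr0.
apply: (vertical_curvature (h := g P.1) (metric_linearl hg P.1)
  (Defs.metric_sym hg P.1)).
exact: hsym.
Qed.

End Uniqueness.

End Warped.

Theorem theorem1p1 (R : realType) (n : nat) (A : atlas 'rV[R]_n)
  (g : pt A -> 'rV[R]_n -> 'rV[R]_n -> R)
  (nabla : pt A -> 'rV[R]_n -> (pt A -> 'rV[R]_n) -> 'rV[R]_n)
  (f1 : R) (phi2 f2 : pt A -> R)
  (nablaG : pt (TM A) -> 'rV[R]_n * 'rV[R]_n ->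
            (pt (TM A) -> 'rV[R]_n * 'rV[R]_n) -> 'rV[R]_n * 'rV[R]_n)
  (hM : manifold A) (hg : riemannian g)
  (hnabla : levi_civita g nabla) (hflat : flat nabla)
  (hf1 : 0 < f1) (hphi2 : smooth_fun setT phi2)
  (hf2 : f2 = fun p => expR (2 * phi2 p))
  (hnablaG : levi_civita (weighted_metric g nabla (fun=> f1) f2) nablaG) :
  let del (P : pt (TM A)) := f2 P.1 / f1 in
  let eps (P : pt (TM A)) :=
    Num.sqrt (g P.1 (grad g phi2 P.1) (grad g phi2 P.1)) in
  (* xi(phi2), for xi tangent to TM *)
  let D (P : pt (TM A)) xi := vder P.1 (dpi P xi) phi2 in
  let v := vpart nabla in
  let br := sasaki g nabla in
  let gradH (P : pt (TM A)) := hlift nabla P (grad g phi2 P.1) in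
  let N := conn_HV nabla in
  (forall (W : set (pt (TM A))) X Y P,
     aopen W -> W P -> smooth_vf W X -> smooth_vf W Y ->
     nablaG P (X P) Y
     = N P (X P) Y + D P (X P) *: v P (Y P) + D P (Y P) *: v P (X P)
       - (del P * br P (v P (X P)) (v P (Y P))) *: gradH P) /\
  (forall (W : set (pt (TM A))) X Y Z P,
     aopen W -> W P -> smooth_vf W X -> smooth_vf W Y -> smooth_vf W Z ->
     curvature nablaG X Y Z P
     = (D P (X P) * D P (Z P)
          + del P * eps P ^+ 2 * br P (v P (X P)) (v P (Z P))
          + br P (N P (X P) gradH) (Z P)) *: v P (Y P)
       - (D P (Y P) * D P (Z P)
          + del P * eps P ^+ 2 * br P (v P (Y P)) (v P (Z P))
          + br P (N P (Y P) gradH) (Z P)) *: v P (X P)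
       - (del P * (D P (X P) * br P (v P (Y P)) (v P (Z P))
                   - D P (Y P) * br P (v P (X P)) (v P (Z P)))) *: gradH P
       - (del P * br P (v P (Y P)) (v P (Z P))) *: N P (X P) gradH
       + (del P * br P (v P (X P)) (v P (Z P))) *: N P (Y P) gradH).
Proof.
move=> del eps D v br gradH N; have hA := manifold_smooth hM.
rewrite hf2 in hnablaG; rewrite /del hf2.
split=> [W X Y P Wo WP WX WY|W X Y Z P Wo WP WX WY WZ].
  exact: (nablaG_warped hA hg hnabla hflat hf1 hphi2 hnablaG Wo WP WX WY).
exact: (curvature_warped hA hg hnabla hflat hf1 hphi2 hnablaG Wo WP WX WY WZ).
Qed.
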